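(* $HD((M\setminus L)\cap (b_{\infty}, B_{\infty})) = HD(X)$, where $$X=\{[0;\gamma]:\gamma\in\{1,2\}^{\mathbb{N}} \text{ not containing any of the words in } P \text{ as a subword}\}.$$
   Context: $HD$ denotes Hausdorff dimension. Let $\mathbb{N}^*=\{1,2,3,\dots\}$ and let $[a_0;a_1,a_2,\dots]=a_0+\frac{1}{a_1+\frac{1}{a_2+\cdots}}$ denote continued fractions. For $A=(a_n)_{n\in\mathbb{Z}}\in(\mathbb{N}^* )^{\mathbb{Z}}$ and $i\in\mathbb{Z}$ put $\lambda_i(A)=[a_i;a_{i+1},a_{i+2},\dots]+[0;a_{i-1},a_{i-2},\dots]$, $\ell(A)=\limsup_{i\to\infty}\lambda_i(A)$, $m(A)=\sup_{i\in\mathbb{Z}}\lambda_i(A)$. The Lagrange and Markov spectra are (by Perron's characterization) $L=\{\ell(A)<\infty:A\in(\mathbb{N}^* )^{\mathbb{Z}}\}$ and $M=\{m(A)<\infty:A\in(\mathbb{N}^* )^{\mathbb{Z}}\}$. Notation: in a sequence, a subscript on a digit is its multiplicity (e.g. $2_3$ means $2,2,2$), and a bar over a block means that this block is repeated periodically forever. Subwords are blocks of consecutive letters. $$b_{\infty} = [2;\overline{1_2,2_3,1,2}]+[0;\overline{1,2_3,1_2,2}] = 3.2930442439\dots,$$ $$B_{\infty} = [2;1,\overline{1,2_3,1,2,1_2,2,1_2,2}]+[0;1,2_3,1_2,2,1,2_3,1_2,2,1,2_2,\overline{1,2_3,1,2,1_2,2,1_2,2}]= 3.2930444814\dots.$$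 $P$ is the set of the nine finite words $(2,1,2,1,2)$, $(2,1,2,1,1,1)$, $(1,1,1,2,1,2)$, $(1,2,1,2,1,1)$, $(1,1,2,1,2,1)$, $(2,2,2,1,2,1,1,2,2,1)$, $(1,2,2,1,1,2,1,2,2,2)$, $(1,2,2,2,1,2,1,1,2,2)$, $(2,2,1,1,2,1,2,2,2,1)$. *)

(* Defs.v *)
From HB Require Import structures.
From mathcomp Require Import all_boot all_order all_algebra.
From mathcomp Require Import all_classical all_reals all_analysis.

Set Implicit Arguments.
Unset Strict Implicit.
Unset Printing Implicit Defensive.

Import Order.TTheory GRing.Theory Num.Theory.
Import numFieldNormedType.Exports.

Local Open Scope classical_set_scope.
Local Open Scope ring_scope.

(** * Hausdorff dimension of subsets of the real line *)

(* This is -oo on the empty set, which [diam_pow] treats separately. *)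
Definition diameter (R : realType) (U : set R) : \bar R :=
  ereal_sup [set `|x - y|%:E | x in U & y in U].

Definition diam_pow (R : realType) (s : R) (U : set R) : \bar R :=
  if pselect (U = set0) then 0%E else poweR (diameter U) s.

Definition hausdorff_premeasure (R : realType) (s d : R) (E : set R) : \bar R :=
  ereal_inf [set (\sum_(0 <= k <oo) diam_pow s (U k))%E | U in
    [set U : nat -> set R | (forall k, (diameter (U k) <= d%:E)%E) /\
                            E `<=` \bigcup_k U k]].

Definition hausdorff_measure (R : realType) (s : R) (E : set R) : \bar R :=
  ereal_sup [set hausdorff_premeasure s d E | d in [set d : R | 0 < d]].

Definition hausdorff_dim (R : realType) (E : set R) : \bar R :=
  ereal_inf [set s%:E | s in
    [set s : R | 0 <= s /\ hausdorff_measure s E = 0%E]].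

(** * Continued fractions *)

(* [a 0; a 1, ..., a n] *)
Fixpoint cfrac_upto (R : realType) (n : nat) (a : nat -> nat) : R :=
  if n is n'.+1 then (a 0%N)%:R + (cfrac_upto R n' (fun k => a k.+1))^-1
  else (a 0%N)%:R.

Definition cfrac (R : realType) (a : nat -> nat) : R :=
  limn (fun n => cfrac_upto R n a).

(* 0, g 0, g 1, ...; thus [cfrac R (zero_then g)] is [0; g 0, g 1, ...] *)
Definition zero_then (g : nat -> nat) : nat -> nat :=
  fun n => if n is k.+1 then g k else 0%N.

(* The sequence consisting of p followed by w repeated forever. *)
Definition evper (p w : seq nat) : nat -> nat :=
  fun n => if (n < size p)%N then nth 0%N p n
           else nth 0%N w ((n - size p) %% size w).

(** * The Lagrange and Markov spectra *)

Definition positive_biseq (A : int -> nat) : Prop := forall i, (0 < A i)%N.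

Definition lambda (R : realType) (A : int -> nat) (i : int) : R :=
  cfrac R (fun n => A (i + n%:Z)) +
  cfrac R (zero_then (fun n => A (i - n.+1%:Z))).

Definition ell (R : realType) (A : int -> nat) : \bar R :=
  limn_esup (fun n : nat => (lambda R A n%:Z)%:E).

Definition markov_value (R : realType) (A : int -> nat) : \bar R :=
  ereal_sup (range (fun i : int => (lambda R A i)%:E)).

(* Equality with x%:E, for a real x, includes finiteness. *)
Definition lagrange_spectrum (R : realType) : set R :=
  [set x | exists2 A, positive_biseq A & ell R A = x%:E].

Definition markov_spectrum (R : realType) : set R :=
  [set x | exists2 A, positive_biseq A & markov_value R A = x%:E].

Arguments lagrange_spectrum : clear implicits.
Arguments markov_spectrum : clear implicits.

(** * The endpoints of the interval and the set X *)

(* 3.2930442439... *)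
Definition b_infty (R : realType) : R :=
  cfrac R (evper [:: 2] [:: 1; 1; 2; 2; 2; 1; 2])%N +
  cfrac R (evper [:: 0] [:: 1; 2; 2; 2; 1; 1; 2])%N.

(* 3.2930444814... *)
Definition B_infty (R : realType) : R :=
  cfrac R (evper [:: 2; 1] [:: 1; 2; 2; 2; 1; 2; 1; 1; 2; 1; 1; 2])%N +
  cfrac R (evper [:: 0; 1; 2; 2; 2; 1; 1; 2; 1; 2; 2; 2; 1; 1; 2; 1; 2; 2]
                 [:: 1; 2; 2; 2; 1; 2; 1; 1; 2; 1; 1; 2])%N.

Definition forbidden : seq (seq nat) :=
  [:: [:: 2; 1; 2; 1; 2];
      [:: 2; 1; 2; 1; 1; 1];
      [:: 1; 1; 1; 2; 1; 2];
      [:: 1; 2; 1; 2; 1; 1];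
      [:: 1; 1; 2; 1; 2; 1];
      [:: 2; 2; 2; 1; 2; 1; 1; 2; 2; 1];
      [:: 1; 2; 2; 1; 1; 2; 1; 2; 2; 2];
      [:: 1; 2; 2; 2; 1; 2; 1; 1; 2; 2];
      [:: 2; 2; 1; 1; 2; 1; 2; 2; 2; 1]]%N.

Definition subword (w : seq nat) (g : nat -> nat) : Prop :=
  exists i : nat, mkseq (fun j => g (i + j)%N) (size w) = w.

Definition X_set (R : realType) : set R :=
  [set cfrac R (zero_then g) | g in
    [set g : nat -> nat | (forall n, g n = 1%N \/ g n = 2%N) /\
                          (forall w, w \in forbidden -> ~ subword w g)]].

Arguments X_set : clear implicits.

(* Main.v *)
Require Import Defs.
From Stdlib Require Import BinNat.
From mathcomp Require Import all_boot all_order all_algebra.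
From mathcomp Require Import all_classical all_reals all_analysis.
From mathcomp Require Import zify ring lra.

Set Implicit Arguments.
Unset Strict Implicit.
Unset Printing Implicit Defensive.

Import Order.TTheory GRing.Theory Num.Theory.
Import numFieldNormedType.Exports.

Local Open Scope classical_set_scope.
Local Open Scope ring_scope.

(** The left endpoint of the interval is the value, at its marked letter 2, of the
    periodic sequence with period 2 1 1 2 2 2 1.  Below the right endpoint this
    sequence is rigid in one direction.  Call the ten letters 1 2 2 2 1 2 1 1 2 2
    around a marked letter of it a central word, the sixth letter being the
    marked one.

    Let the values of a sequence stay below the right endpoint near some
    position.  Finitely many words have to be inspected to see that a value above
    the left endpoint is taken only in the middle of a central word or of its
    mirror image ([central_of_large]), and that a central word is continued on
    the right by the next central word of the periodic sequence, except in one
    situation ([central_step_or_critical]).  In the exceptional situation both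
    tails start like those of the sequence that realises the right endpoint, and
    no admissible continuation can make the value smaller, since every letter
    that would do so completes an excluded word ([no_better_letter]) or makes a
    nearby value too large ([critical_lambda_ge]).  Hence the
    exception is impossible, and a central word forces the periodic sequence on
    its right as far as the values stay below the right endpoint
    ([central_replicates]).

    No point of the interval is in the Lagrange spectrum ([lagrange_gap]): central
    words of the same orientation would occur at arbitrarily large positions,
    the sequence would be periodic between them, and the values there would be
    close to the left endpoint.

    For a point of the Markov spectrum in the interval, up to reversal of the
    sequence, there is a central word, and the sequence is periodic on its right.
    If it is periodic on the left too, there are only countably many
    possibilities.  Otherwise there is a first central word, and what precedes it
    contains no forbidden word, so it is given by a point of the set X.  The
    Markov value is a supremum over the positions from that central word on, and
    each of these values is a 1-Lipschitz function of the point of X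
    ([tail_of_value_lipschitz]).  This bounds the dimension from above
    ([dim_markov_le]).

    Conversely, a sequence avoiding the forbidden words can be attached on the
    left of the periodic half-line by a short connecting word that depends on
    its first four letters only, in such a way that the value at the marked
    position dominates all the others and is in the interval
    ([glued_markov_value]).  On each of the sixteen pieces of X so obtained the
    inverse of the map to the Markov value is Lipschitz, because prepending a
    word of letters 1 and 2 to a continued fraction contracts by a bounded
    factor only.  This bounds the dimension from below ([dim_X_le]). *)

(** * Continued fractions *)

Section ContinuedFractions.
Variable R : realType.
Implicit Types (a s t : nat -> nat).

Definition posseq a := forall n, (0 < a n)%N.
Definition behead_seq a : nat -> nat := fun n => a n.+1.

Lemma posseq_behead a : posseq a -> posseq (behead_seq a).
Proof. by move=> Ha n; exact: Ha. Qed.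

Lemma cfrac_upto_bounds n a : posseq a ->
  (a 0%N)%:R <= cfrac_upto R n a <= (a 0%N)%:R + 1.
Proof.
elim: n a => [|n IH] a Ha /=; first by rewrite lexx lerDl ler01.
have /andP[h _] := IH _ (posseq_behead Ha).
have h1 : 1 <= cfrac_upto R n (fun k => a k.+1).
  by apply: le_trans h; rewrite ler1n; exact: Ha.
rewrite lerDl invr_ge0 (le_trans ler01 h1) /= lerD2l.
by rewrite invf_le1 // (lt_le_trans ltr01 h1).
Qed.

Lemma cfrac_upto_ge1 n a : posseq a -> 1 <= cfrac_upto R n a.
Proof.
move=> Ha; have /andP[h _] := cfrac_upto_bounds n Ha.
by apply: le_trans h; rewrite ler1n.
Qed.

(** Two successive letters contract distances by a factor four, because the
    derivative of [t |-> a + 1 / (b + 1 / t)] is [(b t + 1) ^- 2]. *)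
Lemma two_step_contraction (b : nat) (x y d : R) : (0 < b)%N ->
  1 <= x -> 1 <= y -> `|x - y| <= d ->
  `|(b%:R + x^-1)^-1 - (b%:R + y^-1)^-1| <= d / 4.
Proof.
move=> b0 x1 y1 xy.
have x0 : 0 < x by lra.
have y0 : 0 < y by lra.
have b1 : 1 <= b%:R :> R by rewrite ler1n.
have bx : 2 <= b%:R * x + 1 by nra.
have by_ : 2 <= b%:R * y + 1 by nra.
have -> : (b%:R + x^-1)^-1 - (b%:R + y^-1)^-1
   = (x - y) / ((b%:R * x + 1) * (b%:R * y + 1)).
  by field; rewrite !gt_eqF //=; lra.
rewrite normrM normfV [`|_ * (_ + _)|]ger0_norm; last by nra.
apply: ler_pM => //; first by rewrite invr_ge0; nra.
by rewrite lef_pV2 ?posrE; nra.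
Qed.

Lemma cfrac_upto_near m n n' a s : posseq a -> posseq s ->
  (m.*2 <= n)%N -> (m.*2 <= n')%N ->
  (forall k, (k <= m.*2)%N -> a k = s k) ->
  `|cfrac_upto R n a - cfrac_upto R n' s| <= 4^-1 ^+ m.
Proof.
elim: m n n' a s => [|m IH] n n' a s Ha Hs.
  move=> _ _ /(_ 0%N isT) e; rewrite expr0.
  have /andP[h1 h2] := cfrac_upto_bounds n Ha.
  have /andP[h3 h4] := cfrac_upto_bounds n' Hs.
  by move: h3 h4; rewrite -e => h3 h4; rewrite ler_norml; lra.
rewrite doubleS; case: n => [//|[//|n]]; case: n' => [//|[//|n']].
rewrite !ltnS => hn hn' e /=.
rewrite (e 0%N) // (e 1%N) //.
rewrite [X in `|X|](_ : _ =
  (((s 1%N)%:R + (cfrac_upto R n (fun k => a k.+2))^-1)^-1 -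
   ((s 1%N)%:R + (cfrac_upto R n' (fun k => s k.+2))^-1)^-1)); last by ring.
rewrite exprSr; apply: two_step_contraction; first exact: Hs.
- by apply: cfrac_upto_ge1 => k; exact: Ha.
- by apply: cfrac_upto_ge1 => k; exact: Hs.
by apply: IH => // k hk; exact: e.
Qed.

Lemma cvg_exp4V : (fun m : nat => (4^-1 : R) ^+ m) @ \oo --> (0 : R).
Proof. by apply: cvg_expr; rewrite ger0_norm; lra. Qed.

Lemma exp4V_small (e : R) : 0 < e -> exists m : nat, 4^-1 ^+ m < e.
Proof.
move=> e0; have /cvgrPdist_lt/(_ _ e0)[m _ /(_ m (leqnn m))] := cvg_exp4V.
by rewrite /= sub0r normrN ger0_norm ?exprn_ge0 ?invr_ge0 // => ?; exists m.
Qed.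

Lemma is_cvg_cfrac a : posseq a -> cvgn (fun n => cfrac_upto R n a).
Proof.
move=> Ha; apply/cauchy_cvgP/cauchy_exP => e e0.
have [m hm] := exp4V_small e0.
exists (cfrac_upto R m.*2 a).
exists m.*2 => // n /= hn; rewrite /ball /=; apply: le_lt_trans hm.
exact: cfrac_upto_near.
Qed.

Lemma cfrac_ge1 a : posseq a -> 1 <= cfrac R a.
Proof.
move=> Ha; apply: limr_ge; first exact: is_cvg_cfrac.
by exists 0%N => // n _ /=; exact: cfrac_upto_ge1.
Qed.

Lemma cfrac_gt0 a : posseq a -> 0 < cfrac R a.
Proof. by move=> /cfrac_ge1; apply: lt_le_trans. Qed.

Lemma cfrac_rec a : posseq (behead_seq a) ->
  cfrac R a = (a 0%N)%:R + (cfrac R (behead_seq a))^-1.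
Proof.
move=> Ha; apply/cvg_lim => //.
rewrite -(cvg_shiftn 1); under eq_fun do rewrite addn1 /=.
apply: cvgD; first exact: cvg_cst.
apply: cvgV; last exact: is_cvg_cfrac.
by rewrite gt_eqF // cfrac_gt0.
Qed.

Lemma cfrac_bounds a : posseq a -> (a 0%N)%:R <= cfrac R a <= (a 0%N)%:R + 1.
Proof.
move=> Ha; have Hb := posseq_behead Ha; rewrite cfrac_rec //.
have h1 := cfrac_ge1 Hb; have h0 := cfrac_gt0 Hb.
by rewrite lerDl invr_ge0 (ltW h0) /= lerD2l invf_le1.
Qed.

Lemma cfrac_eq a s : a =1 s -> cfrac R a = cfrac R s.
Proof. by move=> e; congr (cfrac R _); apply/funext. Qed.

Lemma cfrac_zero_then s : posseq s -> cfrac R (zero_then s) = (cfrac R s)^-1.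
Proof. by move=> Hs; rewrite cfrac_rec //= add0r. Qed.

(** The same contraction in the limit: a modulus of continuity that does not
    depend on the letters. *)
Lemma cfrac_near m a s :
  posseq (behead_seq a) -> posseq (behead_seq s) ->
  (forall k, (k <= m.*2)%N -> a k = s k) ->
  `|cfrac R a - cfrac R s| <= 4^-1 ^+ m.
Proof.
elim: m a s => [|m IH] a s Ha Hs e.
  have h1 := cfrac_ge1 Ha; have h0 := cfrac_gt0 Ha.
  have h1' := cfrac_ge1 Hs; have h0' := cfrac_gt0 Hs.
  rewrite (cfrac_rec Ha) (cfrac_rec Hs) (e 0%N) // expr0.
  have : 0 < (cfrac R (behead_seq a))^-1 <= 1 by rewrite invr_gt0 h0 invf_le1.
  have : 0 < (cfrac R (behead_seq s))^-1 <= 1 by rewrite invr_gt0 h0' invf_le1.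
  by move=> /andP[? ?] /andP[? ?]; rewrite ler_norml; lra.
have Ha2 := posseq_behead Ha; have Hs2 := posseq_behead Hs.
rewrite (cfrac_rec Ha) (cfrac_rec Hs) (cfrac_rec Ha2) (cfrac_rec Hs2).
rewrite /behead_seq (e 0%N) // (e 1%N) //.
rewrite [X in `|X|](_ : _ =
  (((s 1%N)%:R + (cfrac R (behead_seq (behead_seq a)))^-1)^-1 -
   ((s 1%N)%:R + (cfrac R (behead_seq (behead_seq s)))^-1)^-1)); last first.
  by rewrite /behead_seq; ring.
rewrite exprSr; apply: two_step_contraction; first exact: (Hs 0%N).
- exact: cfrac_ge1.
- exact: cfrac_ge1.
apply: IH => [||k hk]; [exact: posseq_behead Ha2|exact: posseq_behead Hs2|].
by apply: e; rewrite doubleS !ltnS.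
Qed.

(** The order of two continued fractions is decided by the first letter at
    which they differ: lexicographically at even places and in the opposite
    direction at odd places. *)
Lemma cfrac_le_alternating n a s : posseq (behead_seq a) ->
  posseq (behead_seq s) -> (forall k, (k < n)%N -> a k = s k) ->
  (if odd n then (a n < s n)%N else (s n < a n)%N) -> cfrac R s <= cfrac R a.
Proof.
elim: n a s => [|n IH] a s Ha Hs e /= h.
  rewrite (cfrac_rec Ha) (cfrac_rec Hs).
  have h1 := cfrac_ge1 Hs; have h0 := cfrac_gt0 Ha.
  have : (cfrac R (behead_seq s))^-1 <= 1 by rewrite invf_le1 // cfrac_gt0.
  have : 0 < (cfrac R (behead_seq a))^-1 by rewrite invr_gt0.
  have : (s 0%N)%:R + 1 <= (a 0%N)%:R :> R by rewrite natr1 ler_nat.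
  by move=> ? ? ?; lra.
rewrite (cfrac_rec Ha) (cfrac_rec Hs) (e 0%N) // lerD2l lef_pV2 ?posrE ?cfrac_gt0 //.
apply: IH; [exact: posseq_behead|exact: posseq_behead| |].
  by move=> k hk; rewrite /behead_seq e.
by move: h; rewrite /behead_seq; case: (odd n).
Qed.

(** If the sequences differ within the horizon, the first difference decides
    their order; otherwise their values are close.  Since only finitely many
    letters of [s] matter, the bound is of use for limits superior as well as for
    suprema. *)
Lemma cfrac_ge_of_no_better m s t : posseq (behead_seq s) ->
  posseq (behead_seq t) ->
  (forall n, (n <= m.*2)%N -> (forall k, (k < n)%N -> s k = t k) ->
     ~~ (if odd n then (t n < s n)%N else (s n < t n)%N)) ->
  cfrac R t - 4^-1 ^+ m <= cfrac R s.
Proof.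
move=> Hs Ht H; have e0 : 0 <= (4^-1 : R) ^+ m by rewrite exprn_ge0 // invr_ge0.
have [[n hn]|no] := pselect (exists n, (n <= m.*2)%N && (s n != t n)).
- have ex : exists n, (n <= m.*2)%N && (s n != t n) by exists n.
  case: (ex_minnP ex) => {hn}n /andP[nm hn] hmin.
  have e k : (k < n)%N -> s k = t k.
    move=> kn; apply/eqP; apply: contraLR kn => hk; rewrite -leqNgt.
    have [km|km] := leqP k m.*2; first by apply: hmin; rewrite km hk.
    exact: leq_trans nm (ltnW km).
  suff : cfrac R t <= cfrac R s by lra.
  apply: (cfrac_le_alternating (n := n)) => //.
  by have := H n nm e; case: (odd n); lia.
- have : `|cfrac R s - cfrac R t| <= 4^-1 ^+ m.
    apply: cfrac_near => // k hk; apply/eqP; apply: contra_notT no => hne.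
    by exists k; rewrite hk.
  by rewrite ler_norml; lra.
Qed.

Lemma inv_lipschitz (x y : R) : 1 <= x -> 1 <= y -> `|x^-1 - y^-1| <= `|x - y|.
Proof.
move=> x1 y1; have x0 : x != 0 by rewrite gt_eqF //; lra.
have y0 : y != 0 by rewrite gt_eqF //; lra.
have -> : x^-1 - y^-1 = (y - x) / (x * y) by field; rewrite ?x0 ?y0.
rewrite normrM normfV distrC ler_piMr // invf_le1.
  by rewrite ger0_norm; nra.
by rewrite normr_gt0 mulf_neq0.
Qed.

Lemma inv_expansion (x y : R) : 1 <= x <= 3 -> 1 <= y <= 3 ->
  `|x - y| <= 9 * `|x^-1 - y^-1|.
Proof.
move=> /andP[x1 x3] /andP[y1 y3]; have x0 : x != 0 by rewrite gt_eqF //; lra.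
have y0 : y != 0 by rewrite gt_eqF //; lra.
have -> : x - y = (x * y) * (y^-1 - x^-1) by field; rewrite ?x0 ?y0.
rewrite normrM [`|y^-1 - _|]distrC ler_wpM2r // ger0_norm; nra.
Qed.

Definition shift_seq (k : nat) s : nat -> nat := fun n => s (k + n)%N.

(** Prepending a letter [a] is the map [t |-> 1 / (a + t)] on the reciprocals,
    which does not increase distances; *)
Lemma cfrac_prefix_lipschitz k s t : posseq s -> posseq t ->
  (forall n, (n < k)%N -> s n = t n) ->
  `|(cfrac R s)^-1 - (cfrac R t)^-1| <=
  `|(cfrac R (shift_seq k s))^-1 - (cfrac R (shift_seq k t))^-1|.
Proof.
elim: k s t => [//|k IH] s t Hs Ht e.
apply: le_trans (inv_lipschitz (cfrac_ge1 Hs) (cfrac_ge1 Ht)) _.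
rewrite (cfrac_rec (posseq_behead Hs)) (cfrac_rec (posseq_behead Ht)) (e 0%N) //.
rewrite [X in `|X|](_ : _ = (cfrac R (behead_seq s))^-1 -
                            (cfrac R (behead_seq t))^-1); last by ring.
apply: IH; [exact: posseq_behead|exact: posseq_behead|].
by move=> n hn; apply: e.
Qed.

(** for letters at most 2 its values stay in the interval from 1/3 to 1, where
    taking reciprocals expands by a factor at most 9. *)
Lemma cfrac_prefix_expansion k s t : posseq s -> posseq t ->
  (forall n, (n < k)%N -> s n = t n) -> (forall n, (n < k)%N -> (s n <= 2)%N) ->
  `|(cfrac R (shift_seq k s))^-1 - (cfrac R (shift_seq k t))^-1| <=
  9 ^+ k * `|(cfrac R s)^-1 - (cfrac R t)^-1|.
Proof.
elim: k s t => [|k IH] s t Hs Ht e s2; first by rewrite expr0 mul1r.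
have s2R : (s 0%N)%:R <= 2 :> R by rewrite ler_nat s2.
apply: le_trans (IH _ _ (posseq_behead Hs) (posseq_behead Ht) _ _) _.
- by move=> n hn; apply: e.
- by move=> n hn; apply: s2.
rewrite exprSr -mulrA ler_pM2l ?exprn_gt0 //.
have bs := cfrac_bounds Hs; have bt := cfrac_bounds Ht.
rewrite -(e 0%N) // in bt.
have -> : (cfrac R (behead_seq s))^-1 - (cfrac R (behead_seq t))^-1 =
          cfrac R s - cfrac R t.
  rewrite (cfrac_rec (posseq_behead Hs)) (cfrac_rec (posseq_behead Ht)) (e 0%N) //.
  by ring.
by apply: inv_expansion; rewrite ?cfrac_ge1 //=; lra.
Qed.
End ContinuedFractions.

(** * Hausdorff dimension *)

Section HausdorffDimension.
Variable R : realType.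
Implicit Types (s t : R) (D E U V : set R).

(** For a positive exponent the bound on the diameters of the covering sets can
    be dropped from the definition of a null set, because sets whose diameters
    have a small sum of powers are small.  This form has no supremum in it. *)
Definition hnull t E := forall e : R, 0 < e -> exists U : nat -> set R,
  E `<=` \bigcup_k U k /\ (\sum_(0 <= k <oo) diam_pow t (U k) <= e%:E)%E.

Lemma diam_pow_ge0 t U : (0 <= diam_pow t U)%E.
Proof.
by rewrite /diam_pow; case: (pselect (U = set0)) => h /=; rewrite ?poweR_ge0.
Qed.

Lemma diameter_ge0 U : U !=set0 -> (0 <= diameter U)%E.
Proof.
by move=> [x Ux]; apply: ereal_sup_ubound; exists x => //; exists x;
  rewrite // subrr normr0.
Qed.

Lemma diameter_set0 : diameter (set0 : set R) = -oo%E.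
Proof.
by apply/eqP; rewrite -leeNy_eq; apply: ge_ereal_sup => _ [x []].
Qed.

Lemma diam_pow_neq0 t U : U !=set0 -> diam_pow t U = poweR (diameter U) t.
Proof.
by move=> [x Ux]; rewrite /diam_pow; case: (pselect (U = set0)) => h //=;
  rewrite h in Ux.
Qed.

Lemma diam_pow_set0 t : diam_pow t (set0 : set R) = 0%E.
Proof. by rewrite /diam_pow; case: (pselect _) => h. Qed.

Lemma diam_pow_exponent s t U : 0 <= s -> s <= t -> (diameter U <= 1)%E ->
  (diam_pow t U <= diam_pow s U)%E.
Proof.
move=> s0 st d1; have [->|/set0P Un0] := eqVneq U set0; first by rewrite !diam_pow_set0.
rewrite !diam_pow_neq0 //; have := diameter_ge0 Un0.
case: (diameter U) d1 => [d| |] //; rewrite !poweR_EFin !lee_fin => d1 d0.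
move: d0; rewrite le_eqVlt => /predU1P[<-|d0].
  rewrite /powR eqxx ler_nat; have [t0|//] := eqVneq t 0.
  by suff -> : s == 0; rewrite // eq_le s0 -{1}t0 st.
by rewrite ger_powR // d0.
Qed.

(** Coverings by sets of diameter at most 1 are enough: on these a larger
    exponent gives smaller powers.  The exponent [s] may vanish. *)
Lemma hnull_of_measure0 s t E : 0 <= s -> s < t ->
  hausdorff_measure s E = 0%E -> hnull t E.
Proof.
move=> s0 st H e e0.
have : (hausdorff_premeasure s 1 E < e%:E)%E.
  apply: (@le_lt_trans _ _ 0%E); last by rewrite lte_fin.
  by rewrite -H; apply: ereal_sup_ubound; exists 1; rewrite /= ?ltr01.
move=> /ereal_inf_lt[_ [U [Ud UE] <-] Ue]; exists U; split => //.
apply: le_trans (ltW Ue); apply: lee_nneseries => k *.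
  exact: diam_pow_ge0.
by apply: (diam_pow_exponent s0 (ltW st)); exact: Ud.
Qed.

Lemma hnull_dim_le t E : 0 < t -> hnull t E -> (hausdorff_dim E <= t%:E)%E.
Proof.
move=> t0 H; apply: ereal_inf_lbound; exists t => //=; split; first exact: ltW.
have ge0 d : (0 <= hausdorff_premeasure t d E)%E.
  apply: le_ereal_inf_tmp => _ [U _ <-]; apply: nneseries_ge0 => *.
  exact: diam_pow_ge0.
apply/eqP; rewrite eq_le; apply/andP; split; last first.
  by apply: (le_trans (ge0 1)); apply: ereal_sup_ubound; exists 1; rewrite /= ?ltr01.
apply: ge_ereal_sup => _ [d /= d0 <-]; apply/lee_addgt0Pr => e e0.
rewrite add0e.
(* a total below the power of d forces each diameter to be at most d *)
have [|U [UE Ue]] := H (Num.min e (d `^ t)); first by rewrite lt_min e0 powR_gt0.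
apply: ge_ereal_inf; exists (\sum_(0 <= k <oo) diam_pow t (U k))%E.
  exists U => //; split => // k.
  have [->|/set0P Un0] := eqVneq (U k) set0; first by rewrite diameter_set0 leNye.
  have : (diam_pow t (U k) <= (d `^ t)%:E)%E.
    apply: le_trans (_ : (Num.min e (d `^ t))%:E <= _)%E; last first.
      by rewrite lee_fin ge_min lexx orbT.
    apply: le_trans Ue.
    apply: le_trans (nneseries_lim_ge k.+1 _) => [|n *]; last exact: diam_pow_ge0.
    rewrite big_nat_recr //= leeDr // sume_ge0 // => *; exact: diam_pow_ge0.
  rewrite diam_pow_neq0 // leNgt => h; rewrite leNgt; apply/negP => dU.
  move/negP: h; apply; have := diameter_ge0 Un0.
  case: (diameter (U k)) dU => [u| |] //; last first.
    by move=> *; rewrite eqy_poweR // ltry.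
  rewrite poweR_EFin !lte_fin lee_fin => du u0.
  by rewrite gt0_ltr_powR // nnegrE ltW.
by apply: le_trans Ue _; rewrite lee_fin ge_min lexx.
Qed.

Lemma hausdorff_dim_ge0 E : (0 <= hausdorff_dim E)%E.
Proof. by apply: le_ereal_inf_tmp => _ [s [s0 _] <-]; rewrite lee_fin. Qed.

Lemma dim_le_of_hnull D E : (forall t, 0 < t -> hnull t D -> hnull t E) ->
  (hausdorff_dim E <= hausdorff_dim D)%E.
Proof.
move=> H; have := hausdorff_dim_ge0 D.
case e : (hausdorff_dim D) => [d| |] //; last by move=> _; rewrite leey.
rewrite lee_fin => d0; apply/lee_addgt0Pr => r r0.
have : (hausdorff_dim D < (d + r)%:E)%E by rewrite e lte_fin ltrDl.
move=> /ereal_inf_lt[_ [s [s0 Hs] <-]]; rewrite lte_fin => sd.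
have t0 : 0 < d + r by lra.
by rewrite -EFinD; apply: hnull_dim_le => //; apply: H => //;
  apply: hnull_of_measure0 Hs.
Qed.

Lemma hnull_sub t D E : E `<=` D -> hnull t D -> hnull t E.
Proof.
move=> ED H e e0; have [U [UE Ue]] := H _ e0.
by exists U; split => //; apply: subset_trans UE.
Qed.

Lemma hnull_bigcup t (E : nat -> set R) : (forall k, hnull t (E k)) ->
  hnull t (\bigcup_k E k).
Proof.
move=> H e e0.
have e2 k : 0 < e / (2 ^ k.+1)%:R by rewrite divr_gt0 // ltr0n expn_gt0.
pose U k := sval (cid (H k _ (e2 k))).
have UE k : E k `<=` \bigcup_j U k j by rewrite /U; case: cid => ? [].
have Ue k : (\sum_(0 <= j <oo) diam_pow t (U k j) <= (e / (2 ^ k.+1)%:R)%:E)%E.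
  by rewrite /U; case: cid => ? [].
have /ppcard_eqP[f] : ([set: nat] #= [set: nat * nat])%card.
  by rewrite card_eq_sym; exact: card_nat2.
have fbij : set_bij [set: nat] ([set: nat] `*` [set: nat]) f.
  have := @bijTT _ _ f.
  by rewrite -setTT_bijective/= -[in X in set_bij _ X _ -> _](@setXTT nat nat).
exists (fun n => U (f n).1 (f n).2); split.
  move=> x [k _ /UE[j _ Ux]].
  have [_ _ /(_ (k, j))[|n _ fn]] := fbij; first by split.
  by exists n => //; rewrite fn.
apply: le_trans (epsilon_trick0 xpredT (ltW e0)).
rewrite nneseries_esumT; last by move=> *; exact: diam_pow_ge0.
rewrite -(@reindex_esum R _ _ _ _ f (fun p => diam_pow t (U p.1 p.2)) fbij).
rewrite (_ : _ `*` _ = setT `*`` (fun=> setT)); last by apply/seteqP; split.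
rewrite -(@esum_esum _ _ _ _ _ (fun i j => diam_pow t (U i j))); last first.
  by move=> *; exact: diam_pow_ge0.
rewrite nneseries_esumT; last by move=> k; rewrite lee_fin ltW.
apply: le_esum => k _; rewrite -nneseries_esumT //.
by move=> *; exact: diam_pow_ge0.
Qed.

Lemma hnull_set0 t : hnull t set0.
Proof.
move=> e e0; exists (fun=> set0); split=> //.
by rewrite eseries0 ?lee_fin ?ltW // => *; exact: diam_pow_set0.
Qed.

Lemma hnullU t D E : hnull t D -> hnull t E -> hnull t (D `|` E).
Proof.
move=> HD HE; rewrite -bigcup2E; apply: hnull_bigcup => -[//|[//|k]].
exact: hnull_set0.
Qed.

Lemma hnull_subsingleton t E : 0 < t -> is_subset1 E -> hnull t E.
Proof.
move=> t0 HE e e0; exists (fun k => if k is 0%N then E else set0); split.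
  by move=> x Ex; exists 0%N.
rewrite eseries0 ?lee_fin ?ltW // => -[|k] _ _; last exact: diam_pow_set0.
have [->|/set0P En0] := eqVneq E set0; first exact: diam_pow_set0.
rewrite diam_pow_neq0 //; suff -> : diameter E = 0%E by rewrite poweR0r ?gt_eqF.
apply/eqP; rewrite eq_le diameter_ge0 // andbT.
by apply: ge_ereal_sup => _ [x Ex [y Ey <-]]; rewrite (HE x y) // subrr normr0.
Qed.

Lemma hnull_countable_union t (I : countType) (E : I -> set R) :
  0 < t -> (forall i, is_subset1 (E i)) -> hnull t (\bigcup_i E i).
Proof.
move=> t0 HE; apply: (@hnull_sub _
  (\bigcup_k (if unpickle k is Some i then E i else set0))).
  by move=> x [i _ Ex]; exists (pickle i) => //; rewrite pickleK.
apply: hnull_bigcup => k; case: unpickle => [i|]; last exact: hnull_set0.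
exact: hnull_subsingleton.
Qed.

(** The Lipschitz map is given by its graph [r], because the sets compared below
    are parametrised by sequences of integers and not by each other. *)
Lemma hnull_lipschitz t (C : R) (r : R -> R -> Prop) D E : 0 < t -> 0 < C ->
  (forall y, E y -> exists2 x, D x & r x y) ->
  (forall x x' y y', r x y -> r x' y' -> `|y - y'| <= C * `|x - x'|) ->
  hnull t D -> hnull t E.
Proof.
move=> t0 C0 rE rC H e e0.
have Ct : 0 < C `^ t by rewrite powR_gt0.
have [|U [UE Ue]] := H (e / C `^ t); first by rewrite divr_gt0.
pose V k := [set y | exists2 x, U k x & r x y].
exists V; split.
  move=> y /rE[x /UE[k _ Ux] rxy]; exists k => //; by exists x.
have -> : e%:E = ((C `^ t)%:E * (e / C `^ t)%:E)%E.
  by rewrite -EFinM mulrCA divff ?mulr1 // gt_eqF.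
apply: (@le_trans _ _ ((C `^ t)%:E * \sum_(0 <= k <oo) diam_pow t (U k))%E);
  last by rewrite lee_pmul2l // lte_fin.
rewrite -nneseriesZl; last by move=> *; exact: diam_pow_ge0.
apply: lee_nneseries => [*|k _]; first exact: diam_pow_ge0.
have [->|/set0P Vn0] := eqVneq (V k) set0.
  by rewrite diam_pow_set0 mule_ge0 ?diam_pow_ge0 // lee_fin ltW.
have Un0 : U k !=set0 by case: Vn0 => y [x Ux _]; exists x.
rewrite !diam_pow_neq0 // -poweR_EFin -poweRM ?lee_fin ?(ltW C0) ?diameter_ge0 //.
have dV : (diameter (V k) <= C%:E * diameter (U k))%E.
  apply: ge_ereal_sup => _ [y [x Ux rxy] [y' [x' Ux' rxy'] <-]].
  apply: (@le_trans _ _ (C%:E * `|x - x'|%:E)%E).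
    by rewrite -EFinM lee_fin; exact: rC.
  rewrite lee_pmul2l ?lte_fin //; apply: ereal_sup_ubound.
  by exists x => //; exists x'.
apply: gt0_ler_poweR dV; rewrite ?(ltW t0) // in_itv /= leey andbT.
- exact: diameter_ge0.
- by rewrite mule_ge0 ?diameter_ge0 // lee_fin ltW.
Qed.
End HausdorffDimension.

(** * Rational enclosures *)

Section Fractions.
Variable R : realType.
Implicit Types (x y : N * N).

Definition fadd x y : N * N := (x.1 * y.2 + y.1 * x.2, x.2 * y.2)%num.
Definition fle x y : bool := (x.1 * y.2 <=? y.1 * x.2)%num.
Definition flt x y : bool := (x.1 * y.2 <? y.1 * x.2)%num.
(** The test is made on binary numbers, because [nat_of_bin] would expand the
    denominators in unary. *)
Definition fwf x : bool := (0 <? x.2)%num.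
Definition fval x : R := (nat_of_bin x.1)%:R / (nat_of_bin x.2)%:R.

Lemma nat_of_bin_add (p q : N) : nat_of_bin (p + q)%num = (p + q)%N.
Proof.
by case: p q => [|p] [|q] //=; rewrite ?addn0 // nat_of_add_pos.
Qed.

Lemma nat_of_bin_mul (p q : N) : nat_of_bin (p * q)%num = (p * q)%N.
Proof.
by case: p q => [|p] [|q] //=; rewrite ?muln0 // nat_of_mul_pos.
Qed.

Lemma fwfE x : fwf x = (0 < nat_of_bin x.2)%N.
Proof.
rewrite /fwf; case: x.2 => [|p] //=; apply/esym.
by elim: p => //= p IH; rewrite natTrecE double_gt0.
Qed.

Lemma fadd_wf x y : fwf x -> fwf y -> fwf (fadd x y).
Proof. by rewrite !fwfE /fadd /= nat_of_bin_mul muln_gt0 => -> ->. Qed.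

Lemma fval_add x y : fwf x -> fwf y -> fval (fadd x y) = fval x + fval y.
Proof.
rewrite !fwfE => hx hy; rewrite /fval /fadd /= nat_of_bin_add !nat_of_bin_mul natrD !natrM.
by field; rewrite !pnatr_eq0 -!lt0n; apply/andP; split.
Qed.

Lemma nat_of_bin_le (p q : N) : (p <=? q)%num -> (nat_of_bin p <= nat_of_bin q)%N.
Proof.
move=> /N.leb_le h; rewrite -(N.sub_add _ _ h) nat_of_bin_add; exact: leq_addl.
Qed.

Lemma fle_val x y : fwf x -> fwf y -> fle x y -> fval x <= fval y.
Proof.
rewrite !fwfE => hx hy /nat_of_bin_le; rewrite !nat_of_bin_mul /fval => h.
rewrite ler_pdivrMr ?ltr0n // mulrAC ler_pdivlMr ?ltr0n //.
by rewrite -!natrM ler_nat.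
Qed.

Lemma flt_val x y : fwf x -> fwf y -> flt x y -> fval x < fval y.
Proof.
rewrite !fwfE => hx hy; rewrite /flt N.ltb_antisym => /negP nle.
rewrite ltNge; apply/negP; rewrite /fval ler_pdivrMr ?ltr0n // mulrAC.
rewrite ler_pdivlMr ?ltr0n // -!natrM ler_nat => le; apply: nle.
apply/N.leb_le/N.lt_eq_cases; move: le; rewrite leq_eqVlt -!nat_of_bin_mul.
case/orP => [/eqP e|lt]; first by right; exact: (can_inj nat_of_binK).
left; rewrite -N.ltb_lt N.ltb_antisym; apply/negP => /nat_of_bin_le.
by rewrite leqNgt lt.
Qed.

Definition fnat (n : nat) : N * N := (bin_of_nat n, 1%num).

Lemma fval_nat n : fval (fnat n) = n%:R.
Proof. by rewrite /fval /= bin_of_natK divr1. Qed.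

Definition finv_add (a : nat) x : N * N := (x.2, bin_of_nat a * x.2 + x.1)%num.

Lemma finv_add_wf a x : (0 < a)%N -> fwf x -> fwf (finv_add a x).
Proof.
by rewrite !fwfE => a0 hx; rewrite /finv_add /= nat_of_bin_add nat_of_bin_mul
  bin_of_natK addn_gt0 muln_gt0 a0 hx.
Qed.

Lemma fval_inv_add a x : fwf x -> fval (finv_add a x) = (a%:R + fval x)^-1.
Proof.
rewrite fwfE => hx; have h : (nat_of_bin x.2)%:R != 0 :> R by rewrite pnatr_eq0 -lt0n.
rewrite /fval /finv_add /= nat_of_bin_add nat_of_bin_mul bin_of_natK natrD natrM.
by rewrite -[X in _ = (X + _)^-1](mulfK h) -mulrDl invf_div.
Qed.

(** Enclosure of [0; w, ...] over all continuations of the word [w] by positive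
    integers: the reciprocal of the unknown tail lies between 0 and 1. *)
Fixpoint fbounds (w : seq nat) : (N * N) * (N * N) :=
  if w is a :: w' then
    let b := fbounds w' in (finv_add a b.2, finv_add a b.1)
  else ((0, 1), (1, 1))%num.

Lemma fbounds_correct w s : posseq s ->
  (forall n, (n < size w)%N -> s n = nth 0%N w n) ->
  [/\ fwf (fbounds w).1, fwf (fbounds w).2, 0 <= fval (fbounds w).1 &
   fval (fbounds w).1 <= (cfrac R s)^-1 <= fval (fbounds w).2].
Proof.
elim: w s => [|a w IH] s Hs e /=.
  split=> //; first by rewrite /fval mul0r.
  rewrite /fval /= mul0r divr1 invr_ge0 (le_trans ler01 (cfrac_ge1 R Hs)) /=.
  by rewrite invf_le1 ?cfrac_gt0 // cfrac_ge1.
have e0 : s 0%N = a by exact: (e 0%N).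
have [|n hn|w1 w2 p1 /andP[h1 h2]] := IH (behead_seq s); first exact: posseq_behead.
  by rewrite /behead_seq e.
have a0 : (0 < a)%N by rewrite -e0.
split; [exact: finv_add_wf|exact: finv_add_wf|by rewrite /fval divr_ge0|].
have a0R : 0 < a%:R :> R by rewrite ltr0n.
rewrite !fval_inv_add // cfrac_rec; last exact: posseq_behead.
by rewrite e0 !lef_pV2 ?posrE ?lerD2l ?h1 ?h2 //; lra.
Qed.
End Fractions.

(** * Words in bi-infinite sequences *)

Definition occurs (A : int -> nat) (i : int) (w : seq nat) : Prop :=
  forall n, (n < size w)%N -> A (i + n%:Z) = nth 0%N w n.

Definition lambda_bounds (w : seq nat) (j : nat) : (N * N) * (N * N) :=
  let l := fbounds (rev (take j w)) in
  let r := fbounds (drop j.+1 w) in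
  let c := fnat (nth 0%N w j) in
  (fadd (fadd c r.1) l.1, fadd (fadd c r.2) l.2).

Section Lambda.
Variable R : realType.
Implicit Types (A : int -> nat).

Definition right_tail A (i : int) : nat -> nat := fun n => A (i + n.+1%:Z).
Definition left_tail A (i : int) : nat -> nat := fun n => A (i - n.+1%:Z).

Lemma lambdaE A i : positive_biseq A -> lambda R A i =
  (A i)%:R + (cfrac R (right_tail A i))^-1 + (cfrac R (left_tail A i))^-1.
Proof.
move=> HA; rewrite /lambda cfrac_zero_then; last by move=> n; exact: HA.
rewrite cfrac_rec; last by move=> n; exact: HA.
by rewrite addr0.
Qed.

Lemma lambda_bounds_correct A i w j : positive_biseq A -> occurs A i w ->
  (j < size w)%N ->
  [/\ fwf (lambda_bounds w j).1, fwf (lambda_bounds w j).2 &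
   fval R (lambda_bounds w j).1 <= lambda R A (i + j%:Z)
     <= fval R (lambda_bounds w j).2].
Proof.
move=> HA Hw hj; rewrite lambdaE //.
have [|n|r1 r2 _ /andP[r3 r4]] :=
    @fbounds_correct R (drop j.+1 w) (right_tail A (i + j%:Z)).
- by move=> n; exact: HA.
- rewrite size_drop nth_drop => hn; rewrite /right_tail -Hw; last by lia.
  by congr A; lia.
have [|n|l1 l2 _ /andP[l3 l4]] :=
    @fbounds_correct R (rev (take j w)) (left_tail A (i + j%:Z)).
- by move=> n; exact: HA.
- rewrite size_rev size_take hj => hn.
  rewrite nth_rev ?size_take hj // nth_take; last by lia.
  by rewrite /left_tail -Hw; [congr A; lia|lia].
rewrite /lambda_bounds /=.
split; [by rewrite !fadd_wf|by rewrite !fadd_wf|].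
rewrite !fval_add ?fadd_wf // !fval_nat Hw //.
by apply/andP; split; rewrite !lerD.
Qed.

Lemma lambda_ge_of_bound A i w j q : positive_biseq A -> occurs A i w ->
  (j < size w)%N -> fwf q -> fle q (lambda_bounds w j).1 ->
  fval R q <= lambda R A (i + j%:Z).
Proof.
move=> HA Hw hj hq h; have [w1 _ /andP[h1 _]] := lambda_bounds_correct HA Hw hj.
by apply: le_trans h1; exact: fle_val.
Qed.

Lemma lambda_le_of_bound A i w j q : positive_biseq A -> occurs A i w ->
  (j < size w)%N -> fwf q -> fle (lambda_bounds w j).2 q ->
  lambda R A (i + j%:Z) <= fval R q.
Proof.
move=> HA Hw hj hq h; have [_ w2 /andP[_ h2]] := lambda_bounds_correct HA Hw hj.
by apply: (le_trans h2); exact: fle_val.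
Qed.

Lemma lambda_near A A' i i' m : positive_biseq A -> positive_biseq A' ->
  (forall j : int, (`|j| <= m.*2.+1)%N -> A (i + j) = A' (i' + j)) ->
  `|lambda R A i - lambda R A' i'| <= 2 * 4^-1 ^+ m.
Proof.
move=> HA HA' e; rewrite !lambdaE // -{1}(addr0 i) -{1}(addr0 i') e //.
have pr B k : positive_biseq B -> posseq (right_tail B k) by move=> h n; exact: h.
have pl B k : positive_biseq B -> posseq (left_tail B k) by move=> h n; exact: h.
have hr : `|cfrac R (right_tail A i) - cfrac R (right_tail A' i')| <= 4^-1 ^+ m.
  apply: cfrac_near; [exact/posseq_behead/pr|exact/posseq_behead/pr|].
  by move=> k hk; apply: e; lia.
have hl : `|cfrac R (left_tail A i) - cfrac R (left_tail A' i')| <= 4^-1 ^+ m.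
  apply: cfrac_near; [exact/posseq_behead/pl|exact/posseq_behead/pl|].
  by move=> k hk; apply: e; lia.
have := inv_lipschitz (cfrac_ge1 R (pr _ i HA)) (cfrac_ge1 R (pr _ i' HA')).
have := inv_lipschitz (cfrac_ge1 R (pl _ i HA)) (cfrac_ge1 R (pl _ i' HA')).
move=> /le_trans/(_ hl); rewrite ler_norml => /andP[? ?].
move=> /le_trans/(_ hr); rewrite ler_norml => /andP[? ?].
by rewrite ler_norml; apply/andP; split; lra.
Qed.

Definition reverse_biseq A : int -> nat := fun j => A (- j).

Lemma reverse_positive A : positive_biseq A -> positive_biseq (reverse_biseq A).
Proof. by move=> HA j; exact: HA. Qed.

Lemma lambda_reverse A j : positive_biseq A ->
  lambda R (reverse_biseq A) j = lambda R A (- j).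
Proof.
move=> HA; rewrite !lambdaE //; last exact: reverse_positive.
rewrite addrAC {1}/reverse_biseq; congr (_ + _^-1 + _^-1);
  by apply: cfrac_eq => n; rewrite /left_tail /right_tail /reverse_biseq; congr A; lia.
Qed.

Lemma occurs_reverse A i w : occurs A i w ->
  occurs (reverse_biseq A) (1 - i - (size w)%:Z) (rev w).
Proof.
move=> h n; rewrite size_rev => hn; rewrite nth_rev // -h; last by lia.
by rewrite /reverse_biseq; congr A; lia.
Qed.

Lemma occurs_prefix A i (w : seq nat) j (v : seq nat) : occurs A i w -> (j <= size w)%N ->
  prefix v (drop j w) -> occurs A (i + j%:Z) v.
Proof.
move=> h hj /prefixP[u e] n hn.
have : (n + j < size w)%N.
  have es : (size w - j = size v + size u)%N by rewrite -size_drop e size_cat.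
  by rewrite addnC -ltn_subRL es ltn_addr.
move=> hnj; have -> : i + j%:Z + n%:Z = i + (n + j)%N%:Z by lia.
rewrite h // addnC -nth_drop e nth_cat hn //.
Qed.

Lemma occurs_infix A i (w v : seq nat) : occurs A i w -> infix v w ->
  exists2 j, (j + size v <= size w)%N & occurs A (i + j%:Z) v.
Proof.
move=> h /infixP[p [u e]]; exists (size p).
  by rewrite e !size_cat addnA leq_addr.
apply: (occurs_prefix h); first by rewrite e size_cat leq_addr.
by rewrite e drop_size_cat // prefix_prefix.
Qed.

Lemma occurs_take A (w p : seq nat) k (i : int) : occurs A i w ->
  infix p (take k w) -> exists2 l, (l + size p <= k)%N & occurs A (i + l%:Z) p.
Proof.
move=> o hinf; have szk : (size (take k w) <= k)%N by rewrite size_take_min geq_minl.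
have szw : (size (take k w) <= size w)%N by rewrite size_take_min geq_minr.
have ot : occurs A i (take k w).
  move=> n hn; rewrite o; last exact: leq_trans hn szw.
  by rewrite nth_take // (leq_trans hn szk).
by have [l hl ol] := occurs_infix ot hinf; exists l => //; apply: leq_trans hl szk.
Qed.

Lemma occurs_cons A i a w : occurs A i (a :: w) <-> A i = a /\ occurs A (i + 1) w.
Proof.
split=> [h|[h1 h2] [|n] /= hn]; first split.
- by rewrite -[i]addr0 (h 0%N).
- by move=> n hn; rewrite -[RHS](h n.+1 hn); congr A; lia.
- by rewrite addr0.
- by rewrite -h2 //; congr A; lia.
Qed.

Lemma occurs_rcons A i a w :
  occurs A i (rcons w a) <-> occurs A i w /\ A (i + (size w)%:Z) = a.
Proof.
split=> [h|[h1 h2] n]; first split.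
- by move=> n hn; rewrite h ?size_rcons ?nth_rcons ?hn //; lia.
- by rewrite h ?size_rcons // nth_rcons ltnn eqxx.
- rewrite size_rcons ltnS leq_eqVlt nth_rcons => /orP[/eqP->|hn].
    by rewrite ltnn eqxx.
  by rewrite hn h1.
Qed.

(** Case analysis on the unknown letters of a sequence as a computation: the word
    [w], with a marked position [c], grows until [goal] holds.  The list [ds]
    says at each depth on which side the next letter is revealed (true for the
    left), since the order decides how large the search tree is.  The test is not
    a boolean disjunction because call-by-value evaluation would then explore the
    tree below the places where [goal] already holds. *)
Fixpoint every_extension (goal : nat -> seq nat -> bool) (ds : seq bool)
    (c : nat) (w : seq nat) : bool :=
  if goal c w then true else
  if ds is d :: ds' then
    if d then every_extension goal ds' c.+1 (1%N :: w) &&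
              every_extension goal ds' c.+1 (2%N :: w)
    else every_extension goal ds' c (rcons w 1%N) &&
         every_extension goal ds' c (rcons w 2%N)
  else false.

Lemma every_extension_correct A goal ds (x : int) c w :
  (forall j : int, (`|j - x| <= c + size w + (size ds).*2)%N -> A j = 1%N \/ A j = 2%N) ->
  occurs A (x - c%:Z) w -> every_extension goal ds c w ->
  exists c' w', [/\ goal c' w', occurs A (x - c'%:Z) w',
    (c <= c' <= c + size ds)%N & (size w' <= size w + size ds)%N].
Proof.
elim: ds c w => [|d ds IH] c w H Hw /=; case Hg : (goal c w) => //=.
- by move=> _; exists c, w; split=> //; lia.
- by move=> _; exists c, w; split=> //=; lia.
rewrite /= in H; case: d => /andP[h1 h2].
- have : exists2 a, A (x - c.+1%:Z) = a & every_extension goal ds c.+1 (a :: w).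
    have [e|e] := H (x - c.+1%:Z) ltac:(by rewrite /=; lia).
    + by exists 1%N.
    + by exists 2%N.
  move=> [a ea ha]; have [| |//|c' [w' [g o /= k1 k2]]] := IH c.+1 (a :: w).
  + by move=> j /= hj; apply: H; rewrite /=; lia.
  + by apply/occurs_cons; split=> //; move: Hw; congr (occurs _ _ _); lia.
  by exists c', w'; split=> //=; lia.
- have : exists2 a, A (x - c%:Z + (size w)%:Z) = a & every_extension goal ds c (rcons w a).
    have [e|e] := H (x - c%:Z + (size w)%:Z) ltac:(by rewrite /=; lia).
    + by exists 1%N.
    + by exists 2%N.
  move=> [a ea ha]; have [| |//|c' [w' [g o k1 k2]]] := IH c (rcons w a).
  + by move=> j; rewrite size_rcons => hj; apply: H; rewrite /=; lia.
  + by apply/occurs_rcons.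
  rewrite size_rcons in k2; exists c', w'; split=> //=; lia.
Qed.
End Lambda.

(** * The extremal sequences *)

(** The sequences realising the endpoints, read from their marked letter 2: the
    left one is periodic with [right_period] on the right and [left_period] on the
    left; the right one ends in [min_period] on both sides, after the letter 1 on
    the right and after [left_preperiod] on the left.  Among the tails that are
    possible there, the one of period [min_period] has the smallest value. *)
Definition right_period : seq nat := [:: 1; 1; 2; 2; 2; 1; 2]%N.
Definition left_period : seq nat := [:: 1; 2; 2; 2; 1; 1; 2]%N.
Definition min_period : seq nat := [:: 1; 2; 2; 2; 1; 2; 1; 1; 2; 1; 1; 2]%N.
Definition left_preperiod : seq nat :=
  [:: 1; 2; 2; 2; 1; 1; 2; 1; 2; 2; 2; 1; 1; 2; 1; 2; 2]%N.

(** The letters at the positions from -5 to 4 around the marked letter of the left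
    endpoint.  This word and its mirror image are the last two of [forbidden]. *)
Definition central : seq nat := [:: 1; 2; 2; 2; 1; 2; 1; 1; 2; 2]%N.

(* enclosures of the endpoints, tight enough for all the searches below *)
Definition b_lo : N * N := (32930442439, 10000000000)%num.
Definition b_hi : N * N := (32930442440, 10000000000)%num.
Definition B_lo : N * N := (32930444814, 10000000000)%num.
Definition B_hi : N * N := (32930444815, 10000000000)%num.

Section Endpoints.
Variable R : realType.

Definition all_pos (w : seq nat) := all (fun a => 0 < a)%N w.

Lemma evper_pos p w : all_pos p -> all_pos w -> (0 < size w)%N -> posseq (evper p w).
Proof.
move=> /allP hp /allP hw w0 n; rewrite /evper; case: ifP => hn.
  by apply/hp/mem_nth.
by apply/hw/mem_nth; rewrite ltn_mod.
Qed.

Lemma evper_bounds p w n : all_pos p -> all_pos w -> (0 < size w)%N ->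
  let b := fbounds (mkseq (evper p w) n) in
  [/\ fwf b.1, fwf b.2, 0 <= fval R b.1 &
   fval R b.1 <= (cfrac R (evper p w))^-1 <= fval R b.2].
Proof.
move=> hp hw w0; apply: fbounds_correct; first exact: evper_pos.
by move=> k; rewrite size_mkseq => hk; rewrite nth_mkseq.
Qed.

Lemma two_sided_bounds c p w p' w' n q q' :
  all_pos p -> all_pos w -> (0 < size w)%N ->
  all_pos p' -> all_pos w' -> (0 < size w')%N -> fwf q -> fwf q' ->
  fle q (fadd (fadd (fnat c) (fbounds (mkseq (evper p w) n)).1)
              (fbounds (mkseq (evper p' w') n)).1) ->
  fle (fadd (fadd (fnat c) (fbounds (mkseq (evper p w) n)).2)
              (fbounds (mkseq (evper p' w') n)).2) q' ->
  fval R q <= c%:R + (cfrac R (evper p w))^-1 + (cfrac R (evper p' w'))^-1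
    <= fval R q'.
Proof.
move=> hp hw w0 hp' hw' w0' hq hq' h1 h2.
have [a1 a2 _ /andP[a3 a4]] := evper_bounds n hp hw w0.
have [b1 b2 _ /andP[b3 b4]] := evper_bounds n hp' hw' w0'.
move/(@fle_val R) : h1; rewrite !fval_add ?fadd_wf // fval_nat => /(_ hq isT) h1.
move/(@fle_val R) : h2; rewrite !fval_add ?fadd_wf // fval_nat => /(_ isT hq') h2.
by apply/andP; split; [apply: le_trans h1 _|apply: le_trans _ h2];
  rewrite !lerD.
Qed.

Lemma evper_cons a p w n : evper (a :: p) w n.+1 = evper p w n.
Proof. by []. Qed.

Lemma cfrac_evper_cons a p w : all_pos p -> all_pos w -> (0 < size w)%N ->
  cfrac R (evper (a :: p) w) = a%:R + (cfrac R (evper p w))^-1.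
Proof.
move=> hp hw w0; have h := evper_pos hp hw w0.
by rewrite cfrac_rec.
Qed.

Lemma b_inftyE : b_infty R = 2 + (cfrac R (evper [::] right_period))^-1
                              + (cfrac R (evper [::] left_period))^-1.
Proof. by rewrite /b_infty !cfrac_evper_cons // add0r. Qed.

Lemma B_inftyE : B_infty R = cfrac R (evper [:: 2; 1]%N min_period)
                      + cfrac R (evper (0%N :: left_preperiod) min_period).
Proof. by []. Qed.

Lemma b_infty_bounds : fval R b_lo <= b_infty R <= fval R b_hi.
Proof.
rewrite b_inftyE; apply: (@two_sided_bounds 2 [::] right_period [::] left_period 20);
  by vm_compute.
Qed.

Lemma B_infty_bounds : fval R B_lo <= B_infty R <= fval R B_hi.
Proof.
rewrite B_inftyE (@cfrac_evper_cons 2%N [:: 1%N]) // (@cfrac_evper_cons 0%N left_preperiod) // add0r.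
apply: (@two_sided_bounds 2 [:: 1%N] min_period left_preperiod min_period 20);
  by vm_compute.
Qed.

Lemma B_infty_lt : B_infty R < 10 / 3.
Proof.
have /andP[_ h] := B_infty_bounds; apply: (le_lt_trans h).
apply: (@le_lt_trans _ _ (fval R (33, 10)%num)).
  by apply: fle_val; vm_compute.
by rewrite /fval /=; lra.
Qed.

End Endpoints.

(** * Words excluded below the right endpoint *)

Section Search.
Variable R : realType.
Implicit Types (A : int -> nat) (w p : seq nat).

Definition good_at A (j : int) : Prop :=
  (A j = 1%N \/ A j = 2%N) /\ lambda R A j < B_infty R.

Definition good_ball A (x : int) (r : nat) : Prop :=
  forall j : int, (`|j - x| <= r)%N -> good_at A j.

Lemma good_ball_sub A x r y s : good_ball A x r -> (`|y - x| + s <= r)%N ->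
  good_ball A y s.
Proof. by move=> h hrs j hj; apply: h; lia. Qed.

Lemma good_ball_reverse A x r : positive_biseq A -> good_ball A x r ->
  good_ball (reverse_biseq A) (- x) r.
Proof.
move=> HA h j hj; rewrite /good_at lambda_reverse //.
by apply: (h (- j)); lia.
Qed.

(** A letter at least 4 makes its own value too large.  So the neighbours of a
    letter 3 are at most 3, and each of them adds at least 1/4 to its value. *)
Lemma letters_of_small_lambda A j : positive_biseq A ->
  (forall k : int, (`|k - j| <= 1)%N -> lambda R A k < B_infty R) ->
  A j = 1%N \/ A j = 2%N.
Proof.
move=> HA H; have B := B_infty_lt R.
have pr k : posseq (right_tail A k) by move=> n; exact: HA.
have pl k : posseq (left_tail A k) by move=> n; exact: HA.
have le3 k : (`|k - j| <= 1)%N -> (A k <= 3)%N.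
  move=> /H; rewrite lambdaE // => h; rewrite -ltnS -(ltr_nat R).
  have := cfrac_gt0 R (pr k); have := cfrac_gt0 R (pl k).
  by rewrite -invr_gt0 => h1; rewrite -invr_gt0 => h2; lra.
have := le3 j ltac:(lia); have := HA j.
case e : (A j) => [//|[|[|[|//]]]] _ _; [by left|by right|exfalso].
have quarter s : posseq s -> (s 0%N <= 3)%N -> 1 / 4 <= (cfrac R s)^-1.
  move=> Hs s3; have /andP[_ h] := cfrac_bounds R Hs.
  have s3R : (s 0%N)%:R <= 3 :> R by rewrite ler_nat.
  by rewrite div1r lef_pV2 ?posrE ?cfrac_gt0 //; lra.
have := H j ltac:(lia); rewrite lambdaE // e.
have := quarter _ (pr j) (le3 _ _); have := quarter _ (pl j) (le3 _ _).
by move=> /(_ ltac:(lia)) h1 /(_ ltac:(lia)) h2; lra.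
Qed.

(** With the radius left unspecified, words already excluded can be used to
    exclude further ones without any bookkeeping of the radii. *)
Definition inadmissible (ws : seq (seq nat)) : Prop := exists r, forall A i p,
  positive_biseq A -> p \in ws -> good_ball A i r -> ~ occurs A i p.

Lemma inadmissible_nil : inadmissible [::].
Proof. by exists 0%N. Qed.

(** The numbers in [ks] are the distances to the left of the marked position at
    which the value is tested: some words are excluded only by the value at the
    preceding repetition of the period. *)
Definition excluded (ws : seq (seq nat)) (ks : seq nat) (c : nat) w : bool :=
  if has (fun p => infix p w) ws then true else
  has (fun k => [&& k <= c, c - k < size w &
                    fle B_hi (lambda_bounds w (c - k)).1]%N) ks.

Lemma excludedP ws ks r A x c w K : positive_biseq A ->
  (forall B i p, positive_biseq B -> p \in ws -> good_ball B i r -> ~ occurs B i p) ->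
  occurs A (x - c%:Z) w -> (c + size w <= K)%N -> good_ball A x (K + r) ->
  ~~ excluded ws ks c w.
Proof.
move=> HA Hws Hw hK HG; apply/negP; rewrite /excluded; case: ifP => [/hasP[p pws /(occurs_infix Hw)[j hj Ho]] _|_].
  apply: (Hws A _ p HA pws _ Ho); apply: good_ball_sub HG _.
  have := leq_trans (leq_addr _ _) hj; lia.
move=> /hasP[k _ /and3P[kc hs hle]].
have h := @lambda_ge_of_bound R _ _ _ _ B_hi HA Hw hs isT hle.
have [_] := HG (x - c%:Z + (c - k)%N%:Z) ltac:(lia).
by apply/negP; rewrite -leNgt; have /andP[_ /le_trans] := B_infty_bounds R; apply.
Qed.

(** A successful computation becomes a statement on all sequences whose values
    near the marked position are below the right endpoint. *)
Lemma search ws ks goal ds c w : inadmissible ws ->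
  every_extension (fun c w => excluded ws ks c w || goal c w) ds c w ->
  exists r, forall A x, positive_biseq A -> good_ball A x r ->
    occurs A (x - c%:Z) w ->
  exists c' w', goal c' w' /\ occurs A (x - c'%:Z) w'.
Proof.
move=> [r Hr] Hs; pose K := (c + size w + (size ds).*2)%N.
exists (K + r)%N => A x HA HG Hw.
have [|c' [w' [g o hc hw]]] := every_extension_correct _ Hw Hs.
  move=> j hj; have [] // := HG j; first by rewrite /K; lia.
exists c', w'; split => //; move: g; rewrite -[X in X || _]negbK.
by rewrite (@excludedP ws ks r A x c' w' K) // /K; lia.
Qed.

Lemma inadmissible_search ws ks ds c p : inadmissible ws ->
  every_extension (excluded ws ks) ds c p -> inadmissible (p :: ws).
Proof.
move=> Hws Hs; have [r Hr] := Hws; have [|s Hs'] := @search ws ks (fun _ _ => false) ds c p Hws.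
  move: Hs; congr (is_true (every_extension _ _ _ _)).
  by apply/funext => k; apply/funext => v; rewrite orbF.
exists (c + r + s)%N => A i q HA; rewrite inE => /predU1P[->|qws] HG Hq.
  have [| |c' [w' []] //] := Hs' A (i + c%:Z) HA.
    by apply: good_ball_sub HG _; lia.
  by rewrite addrK.
by apply: (Hr A i q) => //; apply: good_ball_sub HG _; lia.
Qed.

Definition forbidden7 : seq (seq nat) := take 7 forbidden.

(** The last seven words are forbidden because they force a value that is not
    below the right endpoint; the first two contain letters that would improve the tail of period
    [min_period]. *)
Definition inadmissible_words : seq (seq nat) :=
  [:: [:: 2; 1; 2; 2; 2; 1; 2; 1; 1; 2; 2]; [:: 1; 2; 1; 2; 1]]%N
  ++ rev forbidden7.

(** Each word is excluded by the value at one of its letters, once a few more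
    letters are known.  The order matters: the words already excluded prune the
    later searches. *)
Lemma inadmissible_wordsP : inadmissible inadmissible_words.
Proof.
pose l := nseq 5 true; pose r := nseq 5 false.
apply: (@inadmissible_search _ [:: 0%N] r 6); last by vm_compute.
apply: (@inadmissible_search _ [:: 0%N] r 0); last by vm_compute.
apply: (@inadmissible_search _ [:: 0%N] r 5); last by vm_compute.
apply: (@inadmissible_search _ [:: 0%N] l 4); last by vm_compute.
apply: (@inadmissible_search _ [:: 0%N] r 0); last by vm_compute.
apply: (@inadmissible_search _ [:: 0%N]
  [:: false; true; false; true; false; true] 3); last by vm_compute.
apply: (@inadmissible_search _ [:: 0%N] r 3); last by vm_compute.
apply: (@inadmissible_search _ [:: 0%N] l 2); last by vm_compute.
apply: (@inadmissible_search _ [:: 0%N] r 2); last by vm_compute.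
exact: inadmissible_nil.
Qed.

Definition central_at (c : nat) w : bool :=
  (5 <= c)%N && prefix central (drop (c - 5) w).
Definition mirror_at (c : nat) w : bool :=
  (4 <= c)%N && prefix (rev central) (drop (c - 4) w).

Definition alternate (n : nat) : seq bool := flatten (nseq n [:: false; true]).

(** Eight letters on each side of a position are enough: unless they show one of
    the two words or an excluded one, they bound the value by [b_lo]. *)
Lemma central_of_large : exists r, forall A x, positive_biseq A ->
  good_ball A x r -> b_infty R < lambda R A x ->
  occurs A (x - 5) central \/ occurs A (x - 4) (rev central).
Proof.
pose goal c w := [|| (c < size w)%N && fle (lambda_bounds w c).2 b_lo,
  central_at c w | mirror_at c w].
have go a : (a == 1%N) || (a == 2%N) -> every_extension
    (fun c w => excluded inadmissible_words [:: 0%N] c w || goal c w)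
    (alternate 8) 0 [:: a].
  by case/orP => /eqP->; vm_compute.
have [r1 H1] := search inadmissible_wordsP (go 1%N isT).
have [r2 H2] := search inadmissible_wordsP (go 2%N isT).
exists (maxn r1 r2) => A x HA HG Hb.
have : exists c w, goal c w /\ occurs A (x - c%:Z) w.
  have [e|e] := (HG x ltac:(lia)).1.
  - apply: H1 => //; first by apply: good_ball_sub HG _; lia.
    by apply/occurs_cons; rewrite subr0.
  - apply: H2 => //; first by apply: good_ball_sub HG _; lia.
    by apply/occurs_cons; rewrite subr0.
move=> [c [w [/or3P[/andP[hc h]|/andP[hc h]|/andP[hc h]] Hw]]].
- have := @lambda_le_of_bound R _ _ _ _ b_lo HA Hw hc isT h.
  rewrite subrK leNgt => /negP[]; apply: le_lt_trans Hb.
  by have /andP[] := b_infty_bounds R.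
- left; have := occurs_prefix Hw _ h.
  have -> : x - c%:Z + (c - 5)%N%:Z = x - 5 by lia.
  apply; rewrite leqNgt; apply/negP => hs; move: h.
  by rewrite (drop_oversize (ltnW hs)).
- right; have := occurs_prefix Hw _ h.
  have -> : x - c%:Z + (c - 4)%N%:Z = x - 4 by lia.
  apply; rewrite leqNgt; apply/negP => hs; move: h.
  by rewrite (drop_oversize (ltnW hs)).
Qed.

(** The surroundings, in the sequence realising the right endpoint, of its marked
    letter. *)
Definition critical_word : seq nat :=
  (rev left_preperiod ++ [:: 2; 1] ++ min_period)%N.

(** All other ways of not continuing the period contain an excluded word, or make
    the value too large at the central word or 7 letters before it. *)
Lemma central_step_or_critical : exists r, forall A x, positive_biseq A ->
  good_ball A x r -> occurs A (x - 5) central ->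
  occurs A (x + 2) central \/ occurs A (x - 17) critical_word.
Proof.
pose goal c w := prefix central (drop (c + 2) w) ||
  (17 <= c)%N && prefix critical_word (drop (c - 17) w).
have go : every_extension
    (fun c w => excluded inadmissible_words [:: 0; 7]%N c w || goal c w)
    (alternate 9 ++ nseq 3 true) 5 central by vm_compute.
have [r H] := search inadmissible_wordsP go.
exists r => A x HA HG Ho; have [|c [w [/orP[h|/andP[hc h]] Hw]]] := H A x HA HG.
- by have -> : x - 5%:Z = x - 5 by lia.
- left; have := occurs_prefix Hw _ h.
  have -> : x - c%:Z + (c + 2)%N%:Z = x + 2 by lia.
  apply; rewrite leqNgt; apply/negP => hs; move: h.
  by rewrite (drop_oversize (ltnW hs)).
- right; have := occurs_prefix Hw _ h.
  have -> : x - c%:Z + (c - 17)%N%:Z = x - 17 by lia.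
  apply; rewrite leqNgt; apply/negP => hs; move: h.
  by rewrite (drop_oversize (ltnW hs)).
Qed.

End Search.

(** * Replication of the period *)

Section Replication.
Variable R : realType.
Implicit Types (A : int -> nat) (w p : seq nat).

(** How many letters before the place [k] of [min_period] have to be known in
    order to exclude a letter there that would give a smaller value. *)
Definition context_length (k : nat) : nat :=
  if k == 9%N then 10 else if k == 8%N then 5 else
  if (k == 2%N) || (k == 7%N) then 4 else 0.

Lemma context_length_le10 k : (context_length k <= 10)%N.
Proof. by rewrite /context_length; do 3?case: ifP => //. Qed.

Lemma occurs_backwards A y w v :
  (forall i, (0 < i <= size w)%N -> A (y - i%:Z) = nth 0%N w (size w - i)) ->
  occurs A y v -> occurs A (y - (size w)%:Z) (w ++ v).
Proof.
move=> Hw Hv n; rewrite size_cat nth_cat => hn; case: ltnP => hnw.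
  have -> : y - (size w)%:Z + n%:Z = y - (size w - n)%N%:Z by lia.
  by rewrite Hw; [congr nth|]; lia.
have -> : y - (size w)%:Z + n%:Z = y + (n - size w)%N%:Z by lia.
by apply: Hv; lia.
Qed.

(** A smaller letter decreases the value at even places and increases it at odd
    ones.  So the letters 1 at even places and 2 at odd places are optimal anyway;
    at the four remaining places 2, 7, 8 and 9 of the period the better letter
    would complete an inadmissible word. *)
Lemma no_better_letter : exists r, forall A y k, positive_biseq A ->
  good_ball R A y r -> (k < 12)%N ->
  (forall i, (0 < i <= context_length k)%N ->
     A (y - i%:Z) = nth 0%N min_period ((k + 12 - i) %% 12)) ->
  ~~ (if odd k then (nth 0 min_period k < A y)%N
      else (A y < nth 0 min_period k)%N).
Proof.
have [r Hr] := inadmissible_wordsP R.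
exists (r + 10)%N => A y k HA HG hk Hc; apply/negP => better.
have [ey _] := HG y ltac:(lia).
have bad w a : size w = context_length k -> A y = a -> (size w <= 10)%N ->
    (forall i, (0 < i <= context_length k)%N ->
      nth 0%N w (context_length k - i) = nth 0%N min_period ((k + 12 - i) %% 12)) ->
    has (fun p => prefix p (rcons w a)) inadmissible_words -> False.
  move=> sw ya s10 Hw /hasP[p pin pre].
  have o : occurs A (y - (size w)%:Z) (rcons w a).
    rewrite -cats1; apply: occurs_backwards.
      by move=> i; rewrite sw => hi; rewrite Hw // Hc.
    by apply/occurs_cons.
  apply: (Hr A (y - (size w)%:Z) p HA pin); first by apply: good_ball_sub HG _; lia.
  have := @occurs_prefix A _ _ 0 p o isT; rewrite drop0 => /(_ pre).
  by rewrite addr0.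
do 12?[case: k hk Hc better bad => [|k] hk Hc better bad //];
  try by case: ey better => -> //.
- have a1 : A y = 1%N by case: ey better => ->.
  by apply: (bad [:: 1; 2; 1; 2]%N 1%N) => // -[|[|[|[|[|i]]]]].
- have a1 : A y = 2%N by case: ey better => ->.
  by apply: (bad [:: 2; 1; 2; 1]%N 2%N) => // -[|[|[|[|[|i]]]]].
- have a1 : A y = 1%N by case: ey better => ->.
  by apply: (bad [:: 2; 1; 2; 1; 1]%N 1%N) => // -[|[|[|[|[|[|i]]]]]].
- have a1 : A y = 2%N by case: ey better => ->.
  apply: (bad [:: 2; 1; 2; 2; 2; 1; 2; 1; 1; 2]%N 2%N) => //.
  by do 11!case=> //.
Qed.

(** Neither of the two tails can be improved beyond the letters of the critical
    word, up to the horizon of length [m.*2] in which the values are controlled. *)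
Lemma critical_lambda_ge : exists r, forall m A x, positive_biseq A ->
  good_ball R A x (r + m.*2)%N -> occurs A (x - 17) critical_word ->
  B_infty R - 2 * 4^-1 ^+ m <= lambda R A x.
Proof.
have [r Hr] := no_better_letter; exists (r + 40)%N => m A x HA HG Ho.
have HpR : posseq (evper [:: 2; 1]%N min_period) by exact: evper_pos.
have HpL : posseq (evper left_preperiod min_period) by exact: evper_pos.
have oR n : (n < 14)%N -> A (x + n%:Z) = evper [:: 2; 1]%N min_period n.
  move=> hn; have -> : x + n%:Z = x - 17 + (17 + n)%N%:Z by lia.
  rewrite Ho; last by rewrite /critical_word /=; lia.
  by move: n hn; do 14?[case=> //].
have oL n : (0 < n < 18)%N -> A (x - n%:Z) = nth 0%N left_preperiod n.-1.
  move=> hn; have -> : x - n%:Z = x - 17 + (17 - n)%N%:Z by lia.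
  rewrite Ho; last by rewrite /critical_word /=; lia.
  by move: n hn; do 18?[case=> //].
have right : cfrac R (evper [:: 2; 1]%N min_period) - 4^-1 ^+ m <=
             cfrac R (fun n => A (x + n%:Z)).
  apply: cfrac_ge_of_no_better; [by move=> n; exact: HA|exact: posseq_behead|].
  move=> n hn e; have [h|h] := ltnP n 14.
    by rewrite oR // ltnn; case: odd.
  have ev : evper [:: 2; 1]%N min_period n = nth 0%N min_period ((n - 2) %% 12).
    by rewrite /evper /= ltnNge (leq_trans _ h).
  have -> : odd n = odd ((n - 2) %% 12) by lia.
  rewrite ev; apply: Hr => //; [|exact: ltn_pmod|move=> i hi].
    by apply: good_ball_sub HG _; lia.
  have i10 : (0 < i <= 10)%N.
    by have := context_length_le10 ((n - 2) %% 12)%N; lia.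
  have -> : x + n%:Z - i%:Z = x + (n - i)%N%:Z by lia.
  rewrite e; last by lia.
  rewrite /evper /= ltnNge (_ : (1 < n - i)%N) /=; last by lia.
  by congr nth; lia.
have left : cfrac R (evper (0%N :: left_preperiod) min_period) - 4^-1 ^+ m <=
            cfrac R (zero_then (fun n => A (x - n.+1%:Z))).
  apply: cfrac_ge_of_no_better => //; first by move=> n; exact: HA.
  move=> n hn e; case: n hn e => [//|n] hn e; have [h|h] := ltnP n 17.
    have ev : evper (0%N :: left_preperiod) min_period n.+1 = A (x - n.+1%:Z).
      by rewrite evper_cons oL //= /evper (_ : (n < size left_preperiod)%N).
    by rewrite ev /= ltnn; case: ifP.
  have ev : evper (0%N :: left_preperiod) min_period n.+1
            = nth 0%N min_period ((n - 17) %% 12).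
    by rewrite evper_cons /evper /= ltnNge h.
  have -> : odd n.+1 = odd ((n - 17) %% 12) by lia.
  rewrite ev.
  have yE : - (n.+1%:Z - x) = x - n.+1%:Z by lia.
  have [n19|n19] := eqVneq n 19%N.
    (* the context would reach into the preperiod, where the letters differ;
       here the better letter makes the value too large 7 positions before x *)
    apply/negP; rewrite n19 /= => hA.
    have l1 : A (x - 20%:Z) = 1%N.
      by move: hA; have := HA (x - 20%:Z); lia.
    have l2 : A (x - 19%:Z) = 2%N by have := e 19%N; rewrite n19; apply.
    have l3 : A (x - 18%:Z) = 1%N by have := e 18%N; rewrite n19; apply.
    have o : occurs A (x - 20%:Z) (1 :: 2 :: 1 :: critical_word)%N.
      apply/occurs_cons; split=> //; apply/occurs_cons; split.
        by rewrite -l2; congr A; lia.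
      apply/occurs_cons; split; first by rewrite -l3; congr A; lia.
      by move: Ho; congr occurs; lia.
    have := @lambda_ge_of_bound R _ _ _ 13 B_hi HA o isT isT.
    have [_ hB] := HG (x - 20%:Z + 13%:Z) ltac:(lia).
    have hB2 : fval R B_hi > lambda R A (x - 20%:Z + 13%:Z).
      by apply: (lt_le_trans hB); have /andP[] := B_infty_bounds R.
    move=> hh; suff : fval R B_hi <= lambda R A (x - 20%:Z + 13%:Z) by lra.
    by apply: hh; vm_compute.
  have := @Hr (reverse_biseq A) (n.+1%:Z - x) ((n - 17) %% 12)%N.
  rewrite /= -yE; apply; first exact: reverse_positive.
  - by apply: good_ball_sub (good_ball_reverse HA HG) _; lia.
  - exact: ltn_pmod.
  move=> i hi; rewrite /reverse_biseq.
  have i10 := context_length_le10 ((n - 17) %% 12)%N.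
  have -> : - (n.+1%:Z - x - i%:Z) = x - (n.+1 - i)%N%:Z by lia.
  have -> : (n.+1 - i = (n - i).+1)%N by lia.
  have := e (n - i).+1 ltac:(lia); rewrite /= => ->.
  rewrite evper_cons /evper; case: ltnP => /= h17; last by congr nth; lia.
  have hk : (n < 29)%N by lia.
  (* only at the place 9 does the context reach back into the preperiod, by a
     single letter, which agrees with the last letter of the period *)
  move: hi n19; have -> : ((n - 17) %% 12 = n - 17)%N by lia.
  have : (n = 17 + (n - 17))%N by lia.
  move: (n - 17)%N => q nq; rewrite nq => hi q19.
  have [-> ->] : q = 9%N /\ i = 10%N; last by [].
  move: hi q19; rewrite /context_length; case: eqP => [q9|_]; first by lia.
  case: eqP => [q8|_]; first by lia.
  by case: ifP => [/orP[]/eqP q27|_]; lia.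
by rewrite /lambda B_inftyE; lra.
Qed.

(** In the critical situation the value would exceed [y] as soon as the horizon is
    long enough. *)
Lemma central_replicates (y : R) : y < B_infty R ->
  exists r, forall A x, positive_biseq A ->
    (forall j : int, (`|j - x| <= r)%N -> lambda R A j <= y) ->
    occurs A (x - 5) central -> occurs A (x + 2) central.
Proof.
move=> yB; have [r1 H1] := central_step_or_critical R.
have [r2 H2] := critical_lambda_ge.
have e0 : 0 < (B_infty R - y) / 2 by rewrite divr_gt0 // subr_gt0.
have [m hm] := exp4V_small e0.
exists (r1 + r2 + m.*2 + 1)%N => A x HA Hy Hc.
have HG : good_ball R A x (r1 + r2 + m.*2)%N.
  move=> j hj; have lt k : (`|k - j| <= 1)%N -> lambda R A k < B_infty R.
    by move=> hk; apply: le_lt_trans yB; apply: Hy; lia.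
  split; last by apply: lt; lia.
  by apply: letters_of_small_lambda => // k hk; apply: lt.
have HG1 : good_ball R A x r1 by apply: good_ball_sub HG _; lia.
have HG2 : good_ball R A x (r2 + m.*2) by apply: good_ball_sub HG _; lia.
have [//|Ho] := H1 A x HA HG1 Hc; have := H2 m A x HA HG2 Ho.
by have := Hy x ltac:(lia); lra.
Qed.
End Replication.

(** * The periodic sequence *)

Definition bper (k : int) : nat :=
  nth 0%N [:: 2; 1; 1; 2; 2; 2; 1]%N `|(k %% 7)%Z|.

Lemma bper_mod7 k l : (k = l %[mod 7])%Z -> bper k = bper l.
Proof. by rewrite /bper => ->. Qed.

Lemma bper_pos : positive_biseq bper.
Proof.
move=> k; rewrite /bper; have : (`|(k %% 7)%Z| < 7)%N by lia.
move: (absz _); do 7?[case=> //].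
Qed.

Lemma mod7_cases (k : int) (P : int -> Prop) :
  (forall l : int, (k = l %[mod 7])%Z -> P l -> P k) ->
  P 0 -> P 1 -> P 2 -> P 3 -> P 4 -> P 5 -> P 6 -> P k.
Proof.
move=> H h0 h1 h2 h3 h4 h5 h6.
have hm : (k = `|(k %% 7)%Z|%N %[mod 7])%Z by lia.
have hl : (`|(k %% 7)%Z| < 7)%N by lia.
move: (absz _) hm hl => q /H Hq; move: Hq.
by case: q => [|[|[|[|[|[|[|q]]]]]]] Hq // _; apply: Hq.
Qed.

Lemma central_bper A x :
  occurs A (x - 5) central <->
  (forall k : int, -5 <= k <= 4 -> A (x + k) = bper k).
Proof.
split=> [h k hk|h n hn].
- have -> : x + k = x - 5 + (absz (k + 5)%R)%:Z by lia.
  rewrite h /=; last by lia.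
  have hq : (absz (k + 5)%R < 10)%N by lia.
  have -> : bper k = bper ((absz (k + 5)%R)%:Z - 5) by congr bper; lia.
  by move: (absz _) hq; do 10?[case=> //].
- have -> : x - 5 + n%:Z = x + (n%:Z - 5) by lia.
  rewrite h; last by move: hn; rewrite /=; lia.
  by move: n hn; do 10?[case=> //].
Qed.

(** The central word and its mirror image single out a phase and an orientation
    of the period. *)
Lemma bper_central_phase d : occurs bper (d - 5) central -> (7 %| d)%Z.
Proof.
move=> /central_bper.
pose P (d : int) := (forall k : int, -5 <= k <= 4 -> bper (d + k) = bper k) -> (7 %| d)%Z.
apply: (@mod7_cases d P).
- move=> l dl H h; suff : (7 %| l)%Z by lia.
  by apply: H => k hk; rewrite -(h k hk); apply: bper_mod7; lia.
- by [].
all: move=> h; exfalso.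
- by have := h 0 isT.
- by have := h 0 isT.
- by have := h 1 isT.
- by have := h 1 isT.
- by have := h 2 isT.
- by have := h 0 isT.
Qed.

Lemma bper_no_mirror d : ~ occurs bper (d - 4) (rev central).
Proof.
pose P (d : int) := ~ occurs bper (d - 4) (rev central).
apply: (@mod7_cases d P).
- move=> l dl H h; apply: H => n hn; rewrite -h //; apply: bper_mod7; lia.
all: move=> h.
- by have := h 2%N isT.
- by have := h 3%N isT.
- by have := h 1%N isT.
- by have := h 0%N isT.
- by have := h 1%N isT.
- by have := h 0%N isT.
- by have := h 0%N isT.
Qed.

Section PeriodicTails.
Variable R : realType.
Implicit Types (A : int -> nat).

Lemma lambda_bper : lambda R bper 0 = b_infty R.
Proof.
rewrite lambdaE; last exact: bper_pos.
rewrite b_inftyE; congr (_ + _^-1 + _^-1); apply: cfrac_eq => n.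
- rewrite /right_tail /evper /= subn0 add0r.
  have -> : bper n.+1%:Z = bper (n %% 7).+1%:Z by apply: bper_mod7; lia.
  have : (n %% 7 < 7)%N by rewrite ltn_mod.
  by move: (n %% 7)%N; do 7?[case=> //].
- rewrite /left_tail /evper /= subn0 sub0r.
  have -> : bper (- n.+1%:Z) = bper (- (n %% 7).+1%:Z) by apply: bper_mod7; lia.
  have : (n %% 7 < 7)%N by rewrite ltn_mod.
  by move: (n %% 7)%N; do 7?[case=> //].
Qed.

Lemma lambda_near_b A x m : positive_biseq A ->
  (forall k : int, (`|k| <= m.*2.+1)%N -> A (x + k) = bper k) ->
  `|lambda R A x - b_infty R| <= 2 * 4^-1 ^+ m.
Proof.
move=> HA e; rewrite -lambda_bper; apply: lambda_near => //; first exact: bper_pos.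
by move=> k hk; rewrite e // add0r.
Qed.

Lemma bper_of_run A x n :
  (forall t, (t <= n)%N -> occurs A (x + (7 * t)%N%:Z - 5) central) ->
  forall k : int, -5 <= k <= (7 * n + 4)%N%:Z -> A (x + k) = bper k.
Proof.
move=> H k hk; pose t := minn n (absz (k + 5)%R %/ 7).
have /central_bper h := H t (geq_minl _ _).
have := h (k - (7 * t)%N%:Z) ltac:(rewrite /t; lia).
have -> : x + (7 * t)%N%:Z + (k - (7 * t)%N%:Z) = x + k by lia.
by move=> ->; apply: bper_mod7; lia.
Qed.

Lemma bper_right_of_central (y : R) : y < B_infty R -> exists r : nat,
  forall A x n, positive_biseq A ->
    (forall j : int, x - r%:Z <= j <= x + (7 * n + r)%N%:Z -> lambda R A j <= y) ->
    occurs A (x - 5) central ->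
    forall k : int, -5 <= k <= (7 * n + 4)%N%:Z -> A (x + k) = bper k.
Proof.
move=> /central_replicates[r Hr]; exists r => A x n HA Hy Hc.
apply: bper_of_run; elim=> [_|t IH ht]; first by rewrite muln0 addr0.
have := Hr A (x + (7 * t)%N%:Z) HA _ (IH (ltnW ht)).
have -> : x + (7 * t.+1)%N%:Z - 5 = x + (7 * t)%N%:Z + 2 by lia.
by apply=> j hj; apply: Hy; lia.
Qed.

Lemma central_of_occurs_bper A x (K d : int) :
  (forall k : int, -5 <= k <= K -> A (x + k) = bper k) ->
  0 <= d -> d + 5 <= K -> occurs A (x + d - 5) central -> (7 %| d)%Z.
Proof.
move=> HA d0 dK h; apply: bper_central_phase => n hn; rewrite -h // => {h}.
rewrite -HA; first by congr A; lia.
by move: hn; rewrite /=; lia.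
Qed.

(** A central word inside a periodic stretch is in phase with it, so that the
    letters around it agree with [bper] on a long interval. *)
Lemma lambda_near_b_of_central A x (K d : int) m : positive_biseq A ->
  (forall k : int, -5 <= k <= K -> A (x + k) = bper k) ->
  (m.*2)%:Z <= d -> d + (m.*2 + 5)%N%:Z <= K ->
  occurs A (x + d - 5) central -> `|lambda R A (x + d) - b_infty R| <= 2 * 4^-1 ^+ m.
Proof.
move=> HA Hx d0 dK Hc.
have h7 : (7 %| d)%Z by apply: central_of_occurs_bper Hx _ _ Hc; lia.
apply: lambda_near_b => // k hk; rewrite -addrA Hx; last by lia.
by apply: bper_mod7; lia.
Qed.

Lemma central_reverse A x :
  occurs A (x - 4) (rev central) -> occurs (reverse_biseq A) (- x - 5) central.
Proof.
by move=> /occurs_reverse; rewrite revK size_rev; congr occurs; rewrite /=; lia.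
Qed.

(** * The Lagrange spectrum avoids the interval *)

Lemma limn_esup_lt (u : nat -> \bar R) (l y : \bar R) : limn_esup u = l ->
  (l < y)%E -> exists N, forall n, (N <= n)%N -> (u n < y)%E.
Proof.
rewrite limn_esup_lim => <-; rewrite (cvg_lim _ (@cvg_esups_inf _ u)) //.
move=> /ereal_inf_lt[_ [N _ <-] h]; exists N => n hn.
by apply: le_lt_trans h; apply: ereal_sup_ubound; exists n.
Qed.

Lemma limn_esup_gt (u : nat -> \bar R) (l y : \bar R) : limn_esup u = l ->
  (y < l)%E -> forall N, exists2 n, (N <= n)%N & (y < u n)%E.
Proof.
rewrite limn_esup_lim => <-; rewrite (cvg_lim _ (@cvg_esups_inf _ u)) // => h N.
have : (y < esups u N)%E.
  by apply: (lt_le_trans h); apply: ereal_inf_lbound; exists N.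
by move=> /ereal_sup_gt[_ [n hn <-] hy]; exists n.
Qed.

(** A value of the limit superior in the interval would produce infinitely many
    central words of the same orientation.  Replication makes the sequence
    periodic between two of them, and then the value at one of them is close to
    the left endpoint. *)
Lemma lagrange_gap (x : R) : lagrange_spectrum R x -> b_infty R < x ->
  x < B_infty R -> False.
Proof.
move=> [A HA ellA] bx xB.
pose y := (x + B_infty R) / 2; pose b' := (b_infty R + x) / 2.
have yB : y < B_infty R by rewrite /y; lra.
have xy : x < y by rewrite /y; lra.
have bb' : b_infty R < b' by rewrite /b'; lra.
have b'x : b' < x by rewrite /b'; lra.
have [N HN] : exists N, forall j : int, N%:Z <= j -> lambda R A j <= y.
  have [|N HN] := @limn_esup_lt _ _ y%:E ellA; first by rewrite lte_fin.
  exists N => j hj; have -> : j = (absz j)%:Z by lia.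
  by rewrite -lee_fin; apply/ltW/HN; lia.
have large M : exists2 i : int, M%:Z <= i & b' < lambda R A i.
  have [|n hn h] := @limn_esup_gt _ _ b'%:E ellA _ M; first by rewrite lte_fin.
  exists n%:Z; first by lia.
  by rewrite -lte_fin.
have e0 : 0 < (b' - b_infty R) / 2 by rewrite divr_gt0 // subr_gt0.
have [m hm] := exp4V_small e0.
have [r0 H0] := central_of_large R; have [r Hr] := bper_right_of_central yB.
pose S := (r0 + r + m.*2 + 20)%N.
have near_absurd B i : `|lambda R B i - b_infty R| <= 2 * 4^-1 ^+ m ->
    b' < lambda R B i -> False.
  by rewrite ler_norml; lra.
have found i : (N + S)%N%:Z <= i -> b' < lambda R A i ->
    occurs A (i - 5) central \/ occurs A (i - 4) (rev central).
  move=> hi hl; apply: H0 => //; last by lra.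
  move=> j hj; have lt k : N%:Z <= k -> lambda R A k < B_infty R.
    by move=> hk; apply: le_lt_trans yB; exact: HN.
  by split; [apply: letters_of_small_lambda => // k hk|]; apply: lt; lia.
have no_central i : (N + S)%N%:Z <= i -> occurs A (i - 5) central -> False.
  move=> hi Hc; have [i2 hi2 hl2] := large (absz (i + S%:Z)).
  have d0 : 0 <= i2 - i by lia.
  have Hp := Hr A i (absz (i2 - i) + S)%N HA _ Hc.
  have {}Hp : forall k : int, -5 <= k <= i2 - i + S%:Z -> A (i + k) = bper k.
    by move=> k hk; apply: Hp; [move=> j hj; apply: HN; lia|lia].
  have [|hc|hm'] := found i2 _ hl2; first by lia.
  - apply: (near_absurd A i2) => //.
    have -> : i2 = i + (i2 - i) by lia.
    apply: (lambda_near_b_of_central (K := i2 - i + S%:Z)) => //; try lia.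
    by have -> : i + (i2 - i) - 5 = i2 - 5 by lia.
  - apply: (@bper_no_mirror (i2 - i)) => n hn; rewrite -hm' // -Hp.
      by congr A; lia.
    by move: hn; rewrite size_rev /=; lia.
have [i1 hi1 hl1] := large (N + S)%N.
have [i2 hi2 hl2] := large (absz (i1 + S%:Z)).
have [hc1|hm1] := found i1 hi1 hl1; first exact: no_central hc1.
have [|hc2|hm2] := found i2 _ hl2; first by lia.
  by apply: no_central hc2; lia.
have HrA := reverse_positive HA.
have d0 : 0 <= i2 - i1 by lia.
pose n := ((absz (i2 - i1) + m.*2 + 8) %/ 7)%N.
have Hp : forall k : int, -5 <= k <= (7 * n + 4)%N%:Z ->
    reverse_biseq A (- i2 + k) = bper k.
  apply: Hr => //; last exact: central_reverse.
  by move=> j hj; rewrite lambda_reverse //; apply: HN; rewrite /n in hj; lia.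
apply: (near_absurd (reverse_biseq A) (- i1)); last by rewrite lambda_reverse ?opprK.
have e12 : - i1 = - i2 + (i2 - i1) by lia.
rewrite e12; apply: (lambda_near_b_of_central HrA Hp); rewrite ?/n; try lia.
by rewrite -e12; exact: central_reverse.
Qed.
End PeriodicTails.

(** * Markov values in the interval *)

Section UpperBound.
Variable R : realType.
Implicit Types (A : int -> nat) (g : nat -> nat).

Definition X_seq g : Prop :=
  (forall n, g n = 1%N \/ g n = 2%N) /\
  (forall w : seq nat, w \in forbidden -> ~ subword w g).

Lemma X_seq_pos g : X_seq g -> posseq g.
Proof. by move=> [h _] n; case: (h n) => ->. Qed.

Lemma lambda_le_markov A x j : markov_value R A = x%:E -> lambda R A j <= x.
Proof.
by move=> e; rewrite -lee_fin -e; apply: ereal_sup_ubound; exists j.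
Qed.

Lemma markov_reverse A : positive_biseq A ->
  markov_value R (reverse_biseq A) = markov_value R A.
Proof.
move=> HA; congr ereal_sup; apply/seteqP; split=> _ [j _ <-]; exists (- j) => //.
  by rewrite lambda_reverse.
by rewrite lambda_reverse // opprK.
Qed.

Lemma good_of_bounded A (x : R) : positive_biseq A -> x < B_infty R ->
  (forall j, lambda R A j <= x) -> forall y r, good_ball R A y r.
Proof.
move=> HA xB h y r j _; have lt k : lambda R A k < B_infty R by apply: le_lt_trans xB.
by split; [apply: letters_of_small_lambda|].
Qed.

Lemma bper_right_forever A (x : R) p : positive_biseq A -> x < B_infty R ->
  (forall j, lambda R A j <= x) -> occurs A (p - 5) central ->
  forall k : int, -5 <= k -> A (p + k) = bper k.
Proof.
move=> HA xB h Hc k hk; have [r Hr] := bper_right_of_central xB.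
by apply: (Hr A p (absz k)) => //; lia.
Qed.

Lemma central_of_large_forever A (x : R) j : positive_biseq A -> x < B_infty R ->
  (forall j, lambda R A j <= x) -> b_infty R < lambda R A j ->
  occurs A (j - 5) central \/ occurs A (j - 4) (rev central).
Proof.
move=> HA xB h hj; have [r Hr] := central_of_large R.
by apply: Hr => //; exact: good_of_bounded h _ _.
Qed.

(** There are countably many such sequences, because each of them is determined by
    finitely many letters. *)
Definition bi_periodic A (N : nat) : Prop :=
  (forall j : int, N%:Z <= j -> A (j + 7) = A j) /\
  (forall j : int, j <= - N%:Z -> A (j - 7) = A j).

Definition bi_periodic_window A (N : nat) : seq nat :=
  mkseq (fun n => A (n%:Z - (N + 7)%N%:Z)) (2 * N + 15).

Lemma bi_periodic_unique A A' N : bi_periodic A N -> bi_periodic A' N ->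
  bi_periodic_window A N = bi_periodic_window A' N -> A = A'.
Proof.
move=> [r l] [r' l'] e.
have mid j : (`|j| <= N + 7)%N -> A j = A' j.
  move=> hj; have hn : (absz (j + (N + 7)%N%:Z)%R < 2 * N + 15)%N by lia.
  have := congr1 (fun s => nth 0%N s (absz (j + (N + 7)%N%:Z)%R)) e.
  rewrite /bi_periodic_window !nth_mkseq //.
  by have -> : (absz (j + (N + 7)%N%:Z)%R)%:Z - (N + 7)%N%:Z = j by lia.
apply/funext => j; have [n] : exists n, (`|j| <= N + 7 + n)%N by exists (absz j); lia.
elim/ltn_ind: n j => n IH j hj.
have [h|h] := leqP `|j|%N (N + 7)%N; first exact: mid.
have [j0|j0] := leP 0 j.
- have -> : j = (j - 7) + 7 by lia.
  by rewrite r ?r'; [apply: (IH n.-1)| |]; lia.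
- have -> : j = (j + 7) - 7 by lia.
  by rewrite l ?l'; [apply: (IH n.-1)| |]; lia.
Qed.

Definition bi_periodic_values (i : nat * seq nat) : set R :=
  [set x | exists A, [/\ positive_biseq A, bi_periodic A i.1,
     bi_periodic_window A i.1 = i.2 & markov_value R A = x%:E]].

Lemma bi_periodic_values_subset1 i : is_subset1 (bi_periodic_values i).
Proof.
move=> x y [A [_ hA wA eA]] [A' [_ hA' wA' eA']].
have e : A = A' by apply: bi_periodic_unique hA hA' _; rewrite wA wA'.
by move: eA; rewrite e eA' => -[].
Qed.

(** The remaining sequences have a first central word, at the position [p]; the
    real number [t] encodes what lies on the left of it. *)
Definition tail_of_value (t x : R) : Prop := exists A p,
  let g := fun n : nat => A (p - 6 - n%:Z) in
  [/\ positive_biseq A, markov_value R A = x%:E,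
      (forall k : int, -5 <= k -> A (p + k) = bper k) /\
      (forall j, b_infty R < lambda R A j -> p <= j),
      b_infty R < x & X_seq g /\ t = cfrac R (zero_then g)].

(** Only the left tails differ, and these have a common beginning. *)
Lemma lambda_tail_lipschitz A A' p p' (k : nat) : positive_biseq A ->
  positive_biseq A' ->
  (forall k : int, -5 <= k -> A (p + k) = bper k) ->
  (forall k : int, -5 <= k -> A' (p' + k) = bper k) ->
  `|lambda R A (p + k%:Z) - lambda R A' (p' + k%:Z)| <=
  `|(cfrac R (fun n => A (p - 6 - n%:Z)))^-1 -
    (cfrac R (fun n => A' (p' - 6 - n%:Z)))^-1|.
Proof.
move=> HA HA' h h'; rewrite !lambdaE // h ?h'; [|lia|lia].
have -> : cfrac R (right_tail A (p + k%:Z)) = cfrac R (right_tail A' (p' + k%:Z)).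
  by apply: cfrac_eq => n; rewrite /right_tail -!addrA h ?h'; lia.
rewrite opprD addrACA subrr add0r.
apply: (@le_trans _ _ `|(cfrac R (shift_seq (k + 5) (left_tail A (p + k%:Z))))^-1 -
  (cfrac R (shift_seq (k + 5) (left_tail A' (p' + k%:Z))))^-1|).
  apply: cfrac_prefix_lipschitz; try by move=> n; first [exact: HA|exact: HA'].
  by move=> n hn; rewrite /left_tail -!addrA h ?h'; lia.
rewrite le_eqVlt; apply/orP; left; apply/eqP; congr `|_^-1 - _^-1|;
  by apply: cfrac_eq => n; rewrite /shift_seq /left_tail; congr (_ _); lia.
Qed.

(** The Markov value is a supremum of values at positions from [p] on, where
    [lambda_tail_lipschitz] applies; all the other values are at most the left
    endpoint. *)
Lemma tail_of_value_lipschitz t t' x x' :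
  tail_of_value t x -> tail_of_value t' x' -> `|x - x'| <= `|t - t'|.
Proof.
suff half s s' z z' : tail_of_value s z -> tail_of_value s' z' ->
    z <= z' + `|s - s'|.
  move=> h h'; rewrite ler_norml; have := half _ _ _ _ h h'.
  by have := half _ _ _ _ h' h; rewrite distrC => *; apply/andP; split; lra.
move=> [A [p [HA eA [hp hl] bz [Xg es]]]] [A' [p' [HA' eA' [hp' _] _ [Xg' es']]]].
rewrite leNgt; apply/negP => hz.
have : ((Num.max (z' + `|s - s'|) (b_infty R))%:E < markov_value R A)%E.
  by rewrite eA lte_fin gt_max hz bz.
move=> /ereal_sup_gt[_ [j _ <-]]; rewrite lte_fin gt_max => /andP[h1 h2].
have pj := hl j h2; have ej : j = p + (absz (j - p)%R)%:Z by lia.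
have := lambda_tail_lipschitz (absz (j - p)%R) HA HA' hp hp'.
rewrite -ej; move: es es'; rewrite !cfrac_zero_then; last exact: X_seq_pos.
  move=> <- <-; have := lambda_le_markov (p' + (absz (j - p)%R)%:Z) eA'.
  rewrite ler_norml => h3 /andP[_ h4]; clear -h1 h3 h4; lra.
exact: X_seq_pos.
Qed.

Lemma rev_forbidden (w : seq nat) : w \in forbidden ->
  [|| rev w \in inadmissible_words, rev w == central | rev w == rev central].
Proof.
have /allP := (isT : all (fun w => [|| rev w \in inadmissible_words,
  rev w == central | rev w == rev central]) forbidden).
by apply.
Qed.

Lemma X_seq_left A (x : R) p : positive_biseq A -> x < B_infty R ->
  (forall j, lambda R A j <= x) ->
  (forall q, occurs A (q - 5) central -> p <= q) ->
  (forall q, ~ occurs A (q - 4) (rev central)) ->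
  X_seq (fun n => A (p - 6 - n%:Z)).
Proof.
move=> HA xB h Hc Hm; have HG := good_of_bounded HA xB h.
split=> [n|w wf [i hi]].
  by have [|] := HG (p - 6 - n%:Z) 0%N (p - 6 - n%:Z); first by rewrite subrr.
have o : occurs A (p - 6 - i%:Z - (size w)%:Z + 1) (rev w).
  move=> n; rewrite size_rev => hn; rewrite nth_rev //.
  have hk : (size w - n.+1 < size w)%N by lia.
  have := congr1 (fun s => nth 0%N s (size w - n.+1)) hi.
  by rewrite nth_mkseq // => <-; congr A; lia.
case/or3P: (rev_forbidden wf) => [hr|/eqP e|/eqP e].
- have [r Hr] := inadmissible_wordsP R; exact: Hr HA hr (HG _ _) o.
- have sw : size w = 10%N by rewrite -size_rev e.
  have := Hc (p - 6 - i%:Z - (size w)%:Z + 6) _.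
  by rewrite -e => /(_ ltac:(by move: o; congr occurs; lia)); lia.
- have := Hm (p - 6 - i%:Z - (size w)%:Z + 5); rewrite -e; apply.
  by move: o; congr occurs; lia.
Qed.

Lemma bi_periodic_of_bper A p q :
  (forall k : int, -5 <= k -> A (p + k) = bper k) ->
  (forall k : int, -5 <= k -> A (q - k) = bper k) ->
  exists N, bi_periodic A N.
Proof.
move=> hp hq; exists (absz p + absz q)%N; split=> j hj.
- have -> : j + 7 = p + (j - p + 7) by lia.
  have -> : j = p + (j - p) by lia.
  by rewrite !hp; [apply: bper_mod7| |]; lia.
- have -> : j - 7 = q - (q - j + 7) by lia.
  have -> : j = q - (q - j) by lia.
  by rewrite !hq; [apply: bper_mod7| |]; lia.
Qed.

(** Up to reversal there is a central word, so that the right tail is periodic.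
    A mirrored central word, or central words arbitrarily far on the left, make
    the left tail periodic as well; otherwise there is a first central word. *)
Lemma markov_value_cases x : markov_spectrum R x -> b_infty R < x ->
  x < B_infty R ->
  (exists i, bi_periodic_values i x) \/ (exists2 t, X_set R t & tail_of_value t x).
Proof.
move=> [A0 HA0 eA0] bx xB.
have [A [HA eA [i Hi]]] : exists A, [/\ positive_biseq A, markov_value R A = x%:E &
    exists i, occurs A (i - 5) central].
  have : ((b_infty R)%:E < markov_value R A0)%E by rewrite eA0 lte_fin.
  move=> /ereal_sup_gt[_ [i _ <-]]; rewrite lte_fin => hi.
  have le0 j := lambda_le_markov j eA0.
  have [c|c] := central_of_large_forever HA0 xB le0 hi.
    by exists A0; split=> //; exists i.
  exists (reverse_biseq A0); split; first exact: reverse_positive.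
    by rewrite markov_reverse.
  by exists (- i); exact: central_reverse.
have le j := lambda_le_markov j eA.
have per q := bper_right_forever HA xB le (p := q).
have values N : bi_periodic A N -> exists i, bi_periodic_values i x.
  by move=> hN; exists (N, bi_periodic_window A N), A.
have [[q Hq]|no_mirror] := pselect (exists q, occurs A (q - 4) (rev central)).
  left; have leR j : lambda R (reverse_biseq A) j <= x by rewrite lambda_reverse.
  have hq := bper_right_forever (reverse_positive HA) xB leR (central_reverse Hq).
  have [|N /values //] := @bi_periodic_of_bper A i q (per i Hi).
  by move=> k hk; rewrite -(hq k hk) /reverse_biseq; congr A; lia.
have [unb|] := pselect (forall M : int, exists2 p, p <= M & occurs A (p - 5) central).
  left; apply: (values 0%N); split=> j hj.
  - have [p hpj hc] := unb j; have -> : j + 7 = p + (j - p + 7) by lia.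
    have -> : j = p + (j - p) by lia.
    by rewrite !(per p hc); [apply: bper_mod7| |]; lia.
  - have [p hpj hc] := unb (j - 7); have -> : j - 7 = p + (j - p - 7) by lia.
    have -> : j = p + (j - p) by lia.
    by rewrite !(per p hc); [apply: bper_mod7| |]; lia.
move=> bdd; right.
have [M HM] : exists M : int, forall p, occurs A (p - 5) central -> M < p.
  apply: contrapT => h; apply: bdd => M; apply: contrapT => h'; apply: h.
  by exists M => p hp; rewrite ltNge; apply/negP => pM; apply: h'; exists p.
pose cen n := `[< occurs A (M + n%:Z - 5) central >].
have ex : exists n, cen n.
  exists (absz (i - M)%R); apply/asboolP; have := HM i Hi => hMi.
  by have -> : M + (absz (i - M)%R)%:Z - 5 = i - 5 by lia.
case: (ex_minnP ex) => n0 /asboolP hn0 hmin.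
pose p := M + n0%:Z.
have first q : occurs A (q - 5) central -> p <= q.
  move=> hq; have hMq := HM q hq.
  have : (n0 <= absz (q - M)%R)%N.
    apply: hmin; apply/asboolP.
    by have -> : M + (absz (q - M)%R)%:Z - 5 = q - 5 by lia.
  by rewrite /p; lia.
have nm q : ~ occurs A (q - 4) (rev central) by move=> hq; apply: no_mirror; exists q.
have Xg := X_seq_left HA xB le first nm.
exists (cfrac R (zero_then (fun n => A (p - 6 - n%:Z)))).
  by exists (fun n => A (p - 6 - n%:Z)).
exists A, p; split=> //; split; first exact: per.
move=> j hj; have [/first //|/nm //] := central_of_large_forever HA xB le hj.
Qed.

Lemma dim_markov_le :
  (hausdorff_dim ((markov_spectrum R `\` lagrange_spectrum R) `&`
     [set x : R | (b_infty R < x < B_infty R)%R]) <= hausdorff_dim (X_set R))%E.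
Proof.
apply: dim_le_of_hnull => t t0 HX.
apply: (@hnull_sub _ _ ((\bigcup_i bi_periodic_values i) `|`
    [set x | exists2 s, X_set R s & tail_of_value s x])).
  move=> x [[Mx _] /andP[bx xB]].
  by have [[i hi]|h] := markov_value_cases Mx bx xB; [left; exists i|right].
apply: hnullU.
  by apply: hnull_countable_union => // i; exact: bi_periodic_values_subset1.
apply: (hnull_lipschitz (C := 1) (r := tail_of_value) t0 ltr01 _ _ HX) => //.
by move=> s s' x x' h h'; rewrite mul1r; exact: tail_of_value_lipschitz.
Qed.
End UpperBound.

(** * Realising the sequences of X *)

(** The second word of each pair connects the sequences of X that start with the
    first word to the periodic half-line; it has been chosen to make [glue_check]
    succeed. *)
Definition glue_table : seq (seq nat * seq nat) :=
  [:: ([:: 1; 1; 1; 1], [:: 1; 2; 1; 2; 2]);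
      ([:: 1; 1; 1; 2], [:: 1; 2; 1; 2; 2]);
      ([:: 1; 1; 2; 1], [:: 1; 2; 1; 2; 2; 1; 1; 2]);
      ([:: 1; 1; 2; 2], [:: 1; 2; 1; 2; 2]);
      ([:: 1; 2; 1; 1], [:: 1; 2; 1; 2; 2; 1]);
      ([:: 1; 2; 1; 2], [:: 1; 2; 1; 2; 2; 1; 1; 2; 1]);
      ([:: 1; 2; 2; 1], [:: 1; 2; 1; 2; 2]);
      ([:: 1; 2; 2; 2], [:: 1; 2; 1; 2; 2]);
      ([:: 2; 1; 1; 1], [:: 1; 2; 1; 2]);
      ([:: 2; 1; 1; 2], [:: 1; 2; 1; 2; 2; 1; 1]);
      ([:: 2; 1; 2; 1], [:: 1; 2; 1; 2; 2; 1; 2]);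
      ([:: 2; 1; 2; 2], [:: 1; 2; 1; 2; 2; 2]);
      ([:: 2; 2; 1; 1], [:: 1; 2; 1; 2; 2]);
      ([:: 2; 2; 1; 2], [:: 1; 2; 1; 2; 2; 1]);
      ([:: 2; 2; 2; 1], [:: 1; 2; 1; 2]);
      ([:: 2; 2; 2; 2], [:: 1; 2; 1])]%N.

(** The letters between the position 0 and the sequence of X, from right to left;
    the first five of them belong to the central word. *)
Definition left_word (i : seq nat * seq nat) : seq nat :=
  ([:: 1; 2; 2; 2; 1] ++ i.2)%N.

(** The periodic half-line on the right, and on the left of it the word [h] and the
    sequence [g], both read from right to left. *)
Definition glued (h : seq nat) (g : nat -> nat) (j : int) : nat :=
  match j with
  | Posz _ => bper j
  | Negz n => if (n < size h)%N then nth 0%N h n else g (n - size h)%N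
  end.

(** What is known of the glued sequence around the position 0 if [g] starts with
    [u]; the position 0 has the index [size (h ++ u)] in this word. *)
Definition glued_word (h u : seq nat) (r : nat) : seq nat :=
  rev (h ++ u) ++ mkseq (fun n => bper n%:Z) r.

Definition center_lo (h u : seq nat) := (lambda_bounds (glued_word h u 17) (size (h ++ u))).1.
Definition center_hi (h u : seq nat) := (lambda_bounds (glued_word h u 17) (size (h ++ u))).2.

Definition center_check h u : bool :=
  flt b_hi (center_lo h u) && flt (center_hi h u) B_lo.

(** From the position 17 on, the letters within distance 16 are given by [bper],
    so that only the position modulo 7 matters. *)
Definition right_check h u : bool :=
  all (fun j => fle (lambda_bounds (glued_word h u 33) (size (h ++ u) + j.+1)).2
                    (center_lo h u)) (iota 0 16) &&
  all (fun p => fle (lambda_bounds (mkseq (fun n => bper (p%:Z + n%:Z - 16)) 33) 16).2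
                    (center_lo h u)) (iota 0 7).

(** The letters to the left of [h] belong to a sequence of X; reversing them is
    harmless because [forbidden] is closed under reversal. *)
Definition left_goal h u (n c : nat) (w : seq nat) : bool :=
  if has (fun p => infix p (take (c - size h) w)) forbidden then true else
  [&& n < c, c - n.+1 < size w & fle (lambda_bounds w (c - n.+1)).2 (center_lo h u)]%N.

(** Beyond [size h + 8] letters on the left, eight letters on each side belong to
    the sequence of X, and [X_goal] takes over. *)
Definition left_check h u : bool :=
  all (fun n => every_extension (left_goal h u n) (nseq 24 true) (size (h ++ u))
                  (glued_word h u 17)) (iota 0 (size h + 8)).

(** The bound on the size makes sure that at most eight letters to the right of
    the marked one have been inspected. *)
Definition X_goal (c : nat) (w : seq nat) : bool :=
  (size w <= c + 9)%N &&
  (has (fun p => infix p w) forbidden ||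
   (c < size w)%N && fle (lambda_bounds w c).2 b_lo).

Definition glue_check (i : seq nat * seq nat) : bool :=
  [&& center_check (left_word i) i.1, right_check (left_word i) i.1 &
      left_check (left_word i) i.1].

Lemma glue_table_check : all glue_check glue_table.
Proof. by vm_compute. Qed.

Section Gluing.
Variable R : realType.
Variables (h : seq nat) (g : nat -> nat).
Hypothesis h12 : all (fun a => (a == 1%N) || (a == 2%N)) h.
Hypothesis Xg : X_seq g.

Let A := glued h g.

Lemma letter12 j : A j = 1%N \/ A j = 2%N.
Proof.
rewrite /A; case: j => n /=; last first.
  case: ltnP => hn; last exact: Xg.1.
  have /allP/(_ _ (mem_nth 0%N hn)) := h12.
  by case/orP=> /eqP ->; [left|right].
rewrite /bper; have : (absz (n%:Z %% 7)%Z < 7)%N by lia.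
by move: (absz _); do 7?[case=> [_|]; first by auto].
Qed.

Lemma glued_pos : positive_biseq A.
Proof. by move=> j; case: (letter12 j) => ->. Qed.

Lemma glued_right j : 0 <= j -> A j = bper j.
Proof. by case: j. Qed.

Lemma glued_left n : A (- n.+1%:Z) = if (n < size h)%N then nth 0%N h n else g (n - size h)%N.
Proof. by rewrite -NegzE. Qed.

Lemma no_forbidden_left (i : int) (p : seq nat) : p \in forbidden ->
  i + (size p + size h)%N%:Z <= 0 -> ~ occurs A i p.
Proof.
move=> pf hi o; have rf : rev p \in forbidden.
  have /allP := (isT : all (fun p => rev p \in forbidden) forbidden); exact.
apply: (Xg.2 _ rf); exists (absz (- i - (size p + size h)%N%:Z)%R).
apply: (@eq_from_nth _ 0%N); first by rewrite size_mkseq.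
move=> n; rewrite size_mkseq size_rev => hn; rewrite nth_mkseq ?size_rev //.
rewrite nth_rev // -o; last by lia.
have -> : i + (size p - n.+1)%N%:Z =
    - (absz (- i - (size p + size h)%N%:Z)%R + n + size h).+1%:Z by lia.
by rewrite glued_left ltnNge leq_addl /= addnK.
Qed.

Variable u : seq nat.
Hypothesis ug : forall n, (n < size u)%N -> g n = nth 0%N u n.

Let s := size (h ++ u).

Lemma glued_left_word n : (n < s)%N -> A (- n.+1%:Z) = nth 0%N (h ++ u) n.
Proof.
rewrite /s size_cat => hn; rewrite glued_left nth_cat; case: ltnP => // hh.
by rewrite ug //; lia.
Qed.

Lemma occurs_glued_word r : occurs A (0 - s%:Z) (glued_word h u r).
Proof.
move=> n; rewrite /glued_word size_cat size_rev size_mkseq -/s nth_cat size_rev -/s => hn.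
case: ltnP => hns.
  rewrite nth_rev // -/s -glued_left_word; last by lia.
  by congr A; lia.
rewrite nth_mkseq; last by lia.
by rewrite glued_right; [congr bper|]; lia.
Qed.

Hypothesis Hcenter : center_check h u.

Lemma center_bounds : [/\ fwf (center_lo h u), fwf (center_hi h u) &
  fval R (center_lo h u) <= lambda R A 0 <= fval R (center_hi h u)].
Proof.
have [|w1 w2 b] := @lambda_bounds_correct R A (0 - s%:Z) _ s glued_pos (@occurs_glued_word 17%N).
  by rewrite /glued_word size_cat size_rev size_mkseq -/s; lia.
by rewrite subrK in b.
Qed.

Lemma glued_center : b_infty R < lambda R A 0 < B_infty R.
Proof.
have [w1 w2 /andP[b1 b2]] := center_bounds; have /andP[c1 c2] : flt b_hi (center_lo h u) && flt (center_hi h u) B_lo := Hcenter.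
have /andP[_ e1] := b_infty_bounds R; have /andP[e2 _] := B_infty_bounds R.
apply/andP; split.
  by apply: (le_lt_trans e1); apply: lt_le_trans b1; exact: flt_val.
by apply: (le_lt_trans b2); apply: lt_le_trans e2; exact: flt_val.
Qed.

Lemma lambda_le_center i w j : occurs A i w -> (j < size w)%N ->
  fle (lambda_bounds w j).2 (center_lo h u) -> lambda R A (i + j%:Z) <= lambda R A 0.
Proof.
move=> o hj hle; have [w1 _ /andP[b1 _]] := center_bounds.
apply: le_trans b1; exact: (@lambda_le_of_bound R _ _ _ _ _ glued_pos o hj w1 hle).
Qed.

Hypothesis Hright : right_check h u.

Lemma glued_right_le (j : nat) : lambda R A j.+1%:Z <= lambda R A 0.
Proof.
have /andP[/allP h1 /allP h2] := Hright.
have [hj|hj] := ltnP j 16.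
  have := h1 j; rewrite mem_iota => /(_ hj) hle.
  have -> : j.+1%:Z = 0 - s%:Z + (s + j.+1)%N%:Z by lia.
  apply: lambda_le_center (@occurs_glued_word 33%N) _ hle.
  by rewrite [X in (_ < X)%N]size_cat size_rev size_mkseq -/s; lia.
have := h2 (j.+1 %% 7)%N; rewrite mem_iota ltn_mod => /(_ isT) hle.
have -> : j.+1%:Z = j.+1%:Z - 16 + 16%N%:Z by lia.
apply: lambda_le_center _ _ hle; last by rewrite size_mkseq.
move=> n; rewrite size_mkseq => hn; rewrite nth_mkseq // glued_right; last by lia.
by apply: bper_mod7; lia.
Qed.

Hypothesis Hleft : left_check h u.

Lemma glued_left_near_le (n : nat) : (n < size h + 8)%N ->
  lambda R A (- n.+1%:Z) <= lambda R A 0.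
Proof.
move=> hn; have /allP/(_ n) := Hleft; rewrite mem_iota => /(_ hn) hs.
have [|c [w [gl o hc hw]]] := every_extension_correct _ (@occurs_glued_word 17%N) hs.
  by move=> j _; exact: letter12.
move: gl; rewrite /left_goal; case: ifP => [/hasP[p pf hp] _|_ /and3P[nc hcw hle]].
  have [l hl ol] := occurs_take o hp.
  have hsz : (size h <= size (h ++ u))%N by rewrite size_cat leq_addr.
  by exfalso; apply: (no_forbidden_left pf _ ol); move: hc hl hsz; lia.
have -> : - n.+1%:Z = 0 - c%:Z + (c - n.+1)%N%:Z by lia.
exact: lambda_le_center o hcw hle.
Qed.

Lemma X_lambda_le (n : nat) : (size h + 8 <= n)%N ->
  lambda R A (- n.+1%:Z) <= lambda R A 0.
Proof.
move=> hn; have go a : (a == 1%N) || (a == 2%N) ->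
    every_extension X_goal (alternate 8) 0 [:: a].
  by case/orP => /eqP->; vm_compute.
have [c [w [gl o]]] : exists c w, X_goal c w /\ occurs A (- n.+1%:Z - c%:Z) w.
  have o a : A (- n.+1%:Z) = a -> occurs A (- n.+1%:Z - 0%N%:Z) [:: a].
    by move=> e; apply/occurs_cons; rewrite subr0.
  have [e|e] := letter12 (- n.+1%:Z).
  - by have [c [w [? ? _ _]]] := every_extension_correct (fun j _ => letter12 j) (o _ e) (go 1%N isT); exists c, w.
  - by have [c [w [? ? _ _]]] := every_extension_correct (fun j _ => letter12 j) (o _ e) (go 2%N isT); exists c, w.
move: gl => /andP[sz /orP[/hasP[p pf hp]|/andP[hc hle]]].
  have [l hl ol] := occurs_infix o hp.
  exfalso; apply: (no_forbidden_left pf _ ol).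
  by have : (l + size (p : seq nat) <= c + 9)%N := leq_trans hl sz; lia.
have := @lambda_le_of_bound R _ _ _ _ b_lo glued_pos o hc isT hle.
rewrite subrK => h1; apply: (le_trans h1); apply: ltW.
have /andP[bc _] := glued_center; apply: le_lt_trans bc.
by have /andP[] := b_infty_bounds R.
Qed.

Lemma glued_markov_value : markov_value R A = (lambda R A 0)%:E.
Proof.
apply/eqP; rewrite eq_le; apply/andP; split; last first.
  by apply: ereal_sup_ubound; exists 0.
apply: ge_ereal_sup => _ [j _ <-]; rewrite lee_fin; case: j => [[|j]|n].
- by [].
- exact: glued_right_le.
rewrite NegzE; have [hn|hn] := ltnP n (size h + 8); first exact: glued_left_near_le.
exact: X_lambda_le.
Qed.
End Gluing.

Section LowerBound.
Variable R : realType.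

Definition starts_with (u : seq nat) (g : nat -> nat) : Prop :=
  forall n, (n < size u)%N -> g n = nth 0%N u n.

Lemma glue_table_total g : X_seq g ->
  exists2 i, i \in glue_table & starts_with i.1 g.
Proof.
move=> [l12 _].
have [i hi e] : exists2 i, i \in glue_table & i.1 = mkseq g 4.
  rewrite /mkseq /=.
  case: (l12 0%N) => ->; case: (l12 1%N) => ->; case: (l12 2%N) => ->;
    case: (l12 3%N) => ->;
    match goal with |- exists2 i, _ & _ = ?w =>
      exists (nth ([::], [::]) glue_table (find (fun i => i.1 == w) glue_table))
    end; by vm_compute.
by exists i => // n; rewrite e size_mkseq => hn; rewrite nth_mkseq.
Qed.

Definition realised (i : seq nat * seq nat) (x t : R) : Prop := exists g,
  [/\ X_seq g, starts_with i.1 g, t = cfrac R (zero_then g) &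
      x = lambda R (glued (left_word i) g) 0].

Lemma left_word12 i : i \in glue_table ->
  all (fun a => (a == 1%N) || (a == 2%N)) (left_word i).
Proof.
have /allP := (isT : all (fun i => all (fun a => (a == 1%N) || (a == 2%N)) (left_word i)) glue_table).
by apply.
Qed.

Lemma realised_mem i x t : i \in glue_table -> realised i x t ->
  ((markov_spectrum R `\` lagrange_spectrum R) `&`
     [set x : R | b_infty R < x < B_infty R]) x.
Proof.
move=> hi [g [Xg ug _ ->]]; have h12 := left_word12 hi.
have /and3P[c1 c2 c3] := allP glue_table_check i hi.
have /andP[h1 h2] := glued_center R h12 Xg ug c1.
split; last by rewrite /= h1 h2.
split; last by move=> hL; exact: lagrange_gap hL h1 h2.
exists (glued (left_word i) g); first exact: glued_pos.
exact: glued_markov_value c1 c2 c3.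
Qed.

Lemma realised_expansion i x x' t t' : i \in glue_table ->
  realised i x t -> realised i x' t' ->
  `|t - t'| <= 9 ^+ size (left_word i) * `|x - x'|.
Proof.
move=> hi [g [Xg _ -> ->]] [g' [Xg' _ -> ->]]; have h12 := left_word12 hi.
set h := left_word i.
have gp := glued_pos h12 Xg; have gp' := glued_pos h12 Xg'.
rewrite !cfrac_zero_then; [|exact: X_seq_pos|exact: X_seq_pos].
rewrite !lambdaE //.
rewrite (@cfrac_eq R (right_tail (glued h g) 0) (right_tail (glued h g') 0)) //.
rewrite opprD addrACA subrr add0r.
have tail f : cfrac R f = cfrac R (shift_seq (size h) (left_tail (glued h f) 0)).
  apply: cfrac_eq => n; rewrite /shift_seq /left_tail sub0r glued_left.
  by rewrite ltnNge leq_addr /= addKn.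
rewrite (tail g) (tail g'); apply: cfrac_prefix_expansion.
- by move=> n; exact: gp.
- by move=> n; exact: gp'.
- by move=> n hn; rewrite /left_tail !sub0r !glued_left hn.
- move=> n hn; rewrite /left_tail sub0r glued_left hn.
  by have /allP/(_ _ (mem_nth 0%N hn)) := h12; case/orP => /eqP ->.
Qed.

Lemma dim_X_le : (hausdorff_dim (X_set R) <=
  hausdorff_dim ((markov_spectrum R `\` lagrange_spectrum R) `&`
     [set x : R | (b_infty R < x < B_infty R)%R]))%E.
Proof.
apply: dim_le_of_hnull => s s0 HZ.
pose E k := [set t | exists2 x, realised (nth ([::], [::]) glue_table k) x t &
                                (k < size glue_table)%N].
apply: (@hnull_sub _ _ (\bigcup_k E k)).
  move=> _ [g Xg <-]; have [i hi ug] := glue_table_total Xg.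
  exists (index i glue_table) => //.
  exists (lambda R (glued (left_word i) g) 0); last by rewrite index_mem.
  by rewrite nth_index //; exists g.
apply: hnull_bigcup => k; set i := nth ([::], [::]) glue_table k.
have [hk|hk] := ltnP k (size glue_table); last first.
  by apply: hnull_sub (hnull_set0 _) => t [x _]; rewrite ltnNge hk.
have hi : i \in glue_table by exact: mem_nth.
apply: (hnull_lipschitz (C := 9 ^+ size (left_word i)) (r := realised i) s0 _ _ _ HZ).
- by rewrite exprn_gt0.
- by move=> t [x hx _]; exists x => //; exact: realised_mem hx.
- by move=> x x' t t'; exact: realised_expansion.
Qed.
End LowerBound.

Theorem theorem3p1 (R : realType) :
  hausdorff_dim
    ((markov_spectrum R `\` lagrange_spectrum R) `&`
     [set x : R | (b_infty R < x < B_infty R)%R])%classic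
  = hausdorff_dim (X_set R).
Proof. by apply/eqP; rewrite eq_le dim_markov_le dim_X_le. Qed.
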